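(* Let $\mathfrak L$ be an affine Lie superalgebra as in the context. Suppose that $M$ is a simple admissible $\mathfrak L$-module of level zero and $\alpha\in R_0\cap R_{re}$ is such that $\pm\alpha\in R^{in}(M)$. Then there is a zero-level simple admissible $\mathfrak L$-module $\Omega$ such that (1) $M$ is a twisted localization of $\Omega$ using a complex number; (2) $\alpha\in R^{ln}(\Omega)$; (3) for $\beta\in R_{re}$, if $\beta\in R^{ln}(M)$, then $\beta\in R^{ln}(\Omega)$.
   Context: The base field is $\mathbb C$. $\mathfrak L=\mathfrak L_0\oplus\mathfrak L_1$ is an affine Lie superalgebra (untwisted or twisted, in the sense of Kac and van de Leur) with $\mathfrak L_1\neq\{0\}$, which is neither of type $A(1,2\ell-1)^{(2)}$ nor of type $X^{(1)}$ with $X$ a basic classical simple Lie superalgebra of type I. $\mathfrak h\subseteq\mathfrak L_0$ is its standard Cartan subalgebra, $\mathfrak L=\bigoplus_{\alpha\in R}\mathfrak L^\alpha$, $R=R_0\cup R_1$, $R_i=\{\alpha\in R\mid\mathfrak L_i\cap\mathfrak L^\alpha\neq\{0\}\}$ (elements of $R_0$ are called even), $Q={\rm span}_{\mathbb Z}R$, $c$ is the canonical central element (level zero means $c$ acts as $0$). $(\cdot,\cdot)$ is the form on $\mathfrak h^*$ induced from the nondegenerate invariant even supersymmetric form of $\mathfrak L$, and $R_{re}=\{\alpha\in R\mid(\alpha,\alpha)\neq0\}$ (real roots). A weight module is $M=\bigoplus_{\lambda\in\mathfrak h^*}M^\lambda$ with $M^\lambda=\{v\mid hv=\lambda(h)v\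 \forall h\in\mathfrak h\}$; its support is $\{\lambda\mid M^\lambda\neq\{0\}\}$; it is a finite weight module if every $M^\lambda$ is finite dimensional. A finite weight $\mathfrak L$-module is admissible if the dimensions of its weight spaces are uniformly bounded and its support lies in a single coset of $\mathfrak h^*/Q$. $R^{in}(M)$ (resp. $R^{ln}(M)$) is the set of $\alpha\in R_{re}$ such that $0\neq x\in\mathfrak L^\alpha$ acts injectively (resp. locally nilpotently) on $M$. Twisted localization. Let $\alpha\in R_0\cap R_{re}$, $0\neq f\in\mathfrak L_0\cap\mathfrak L^\alpha$, $U=U(\mathfrak L)$ (universal enveloping algebra) and let $U_\alpha$ be the localization of $U$ at the Ore set $\{f^n\mid n\geq0\}$, so $U\subseteq U_\alpha$. For a $U$-module $M$ put $D_\alpha(M)=U_\alpha\otimes_UM$. For $x\in\mathbb C$ let $\Theta_\alpha^x:U_\alpha\to U_\alpha$, $\Theta_\alpha^x(u)=\sum_{i\geq0}\binom{x}{i}{\rm ad}(f)^i(u)f^{-i}$, where $\binom{x}{0}=1$ and $\binom{x}{i}=x(x-1)\cdots(x-i+1)/i!$. For a $U_\alpha$-module $\Omega$ let $\Omega(x)$ denote $\Omega$ with $U_\alpha$-action twisted by $\Theta_\alpha^x$, and put $D_\alpha^x(M)=(D_\alpha(M))(x)$, regarded also as an $\mathfrak L$-module. A simple finite weight module $M$ is a twisted localization of a simple finite weight module $N$ using $x$ if $M\simeq D_\alpha^x(N)$ for some real even root $\alpha$. *)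

(* Defs.v *)
From HB Require Import structures.
From mathcomp Require Import all_boot all_order all_algebra.
From mathcomp Require Import all_classical all_reals.

Set Implicit Arguments.
Unset Strict Implicit.
Unset Printing Implicit Defensive.

Import Order.TTheory GRing.Theory.

Local Open Scope classical_set_scope.
Local Open Scope quotient_scope.
Local Open Scope ring_scope.

(* Parities are booleans: false is even, true is odd. *)

Definition subspace (K : fieldType) (V : lmodType K) (P : set V) : Prop :=
  P 0 /\ forall (a : K) u v, P u -> P v -> P (a *: u + v).

Definition grading (K : fieldType) (V : lmodType K) (hom : bool -> set V) :
    Prop :=
  [/\ forall b, subspace (hom b),
      forall v, exists v0 v1, [/\ hom false v0, hom true v1 & v = v0 + v1]
    & forall v, hom false v -> hom true v -> v = 0].

Definition graded_subspace (K : fieldType) (V : lmodType K)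
    (hom : bool -> set V) (P : set V) : Prop :=
  subspace P /\
  forall v0 v1, hom false v0 -> hom true v1 -> P (v0 + v1) -> P v0 /\ P v1.

Definition bilinear_op (K : fieldType) (U V W : lmodType K) (op : U -> V -> W) :
    Prop :=
  (forall a x y v, op (a *: x + y) v = a *: op x v + op y v) /\
  (forall x a u v, op x (a *: u + v) = a *: op x u + op x v).

Record lieSuper (K : fieldType) (L : lmodType K) := LieSuper {
  lhom : bool -> set L;
  br : L -> L -> L;
  lhom_grading : grading lhom;
  br_bilinear : bilinear_op br;
  br_lhom : forall a b x y, lhom a x -> lhom b y -> lhom (a (+) b) (br x y);
  br_skew : forall a b x y, lhom a x -> lhom b y ->
    br x y = - (-1) ^+ (a && b) *: br y x;
  br_jacobi : forall a b x y z, lhom a x -> lhom b y ->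
    br x (br y z) = br (br x y) z + (-1) ^+ (a && b) *: br y (br x z)
}.

Record superModule (K : fieldType) (L : lmodType K) (LL : lieSuper L)
    (M : lmodType K) := SuperModule {
  mhom : bool -> set M;
  act : L -> M -> M;
  mhom_grading : grading mhom;
  act_bilinear : bilinear_op act;
  act_mhom : forall a b x m,
    lhom LL a x -> mhom b m -> mhom (a (+) b) (act x m);
  act_br : forall a b x y m, lhom LL a x -> lhom LL b y ->
    act (br LL x y) m = act x (act y m) - (-1) ^+ (a && b) *: act y (act x m)
}.

Definition simple_module (K : fieldType) (L : lmodType K) (LL : lieSuper L)
    (M : lmodType K) (MM : superModule LL M) : Prop :=
  (exists m : M, m <> 0) /\
  forall P : set M, graded_subspace (mhom MM) P ->
    (forall x m, P m -> P (act MM x m)) ->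
    (forall m, P m -> m = 0) \/ (forall m, P m).

Definition simple_lieSuper (K : fieldType) (g : lmodType K) (G : lieSuper g) :
    Prop :=
  (exists x y, br G x y <> 0) /\
  forall I : set g, graded_subspace (lhom G) I ->
    (forall x y, I y -> I (br G x y)) ->
    (forall y, I y -> y = 0) \/ (forall y, I y).

Definition even_stable (K : fieldType) (g : lmodType K) (G : lieSuper g)
    (W : set g) : Prop :=
  [/\ subspace W, W `<=` lhom G true
    & forall x y, lhom G false x -> W y -> W (br G x y)].

Definition odd_part_completely_reducible (K : fieldType) (g : lmodType K)
    (G : lieSuper g) : Prop :=
  forall W, even_stable G W -> exists W', [/\ even_stable G W',
    forall y, W y -> W' y -> y = 0
  & forall y, lhom G true y -> exists w w', [/\ W w, W' w' & y = w + w']].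

Definition invariant_form (K : fieldType) (g : lmodType K) (G : lieSuper g)
    (kappa : g -> g -> K) : Prop :=
  [/\ bilinear_op (kappa : g -> g -> K^o),
      forall x y, lhom G false x -> lhom G true y -> kappa x y = 0,
      forall a b x y, lhom G a x -> lhom G b y ->
        kappa x y = (-1) ^+ (a && b) * kappa y x,
      forall x y z, kappa (br G x y) z = kappa x (br G y z)
    & forall x, (forall y, kappa x y = 0) -> x = 0].

(* Simple, classical (g_1 is completely reducible over g_0) and basic (there is
   an invariant form); simple Lie algebras (g_1 = 0) are included. *)
Definition basic_classical (K : fieldType) (g : vectType K) (G : lieSuper g) :
    Prop :=
  [/\ simple_lieSuper G, odd_part_completely_reducible G
    & exists kappa, invariant_form G kappa].

(* Type I: the odd part is nonzero and reducible over the even part; in type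
   II it is irreducible. *)
Definition type_I (K : fieldType) (g : lmodType K) (G : lieSuper g) : Prop :=
  exists W, [/\ even_stable G W, exists y, W y /\ y <> 0
    & exists y, lhom G true y /\ ~ W y].

Section Matrices.
Variables (K : fieldType) (p q : nat).
Implicit Types X Y : 'M[K]_(p + q).

Definition mxhom (b : bool) X : Prop :=
  if b then ulsubmx X = 0 /\ drsubmx X = 0
  else ursubmx X = 0 /\ dlsubmx X = 0.

Definition supertrace X : K := \tr (ulsubmx X) - \tr (drsubmx X).

Definition supertranspose X : 'M[K]_(p + q) :=
  block_mx (ulsubmx X)^T (dlsubmx X)^T (- (ursubmx X)^T) (drsubmx X)^T.

(* For the even form on K^(p|q) with Gram matrix diag(1, J), this is
   X |-> - X^*, with X^* the superadjoint of X. *)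
Definition minus_superadjoint (J : 'M[K]_q) X : 'M[K]_(p + q) :=
  let F := block_mx 1%:M 0 0 J in - (invmx F *m supertranspose X *m F).

(* g is isomorphic, through f, to the quotient by the ideal N of the subalgebra
   S of gl(p|q). *)
Definition mx_presentation (g : lmodType K) (G : lieSuper g)
    (S N : set 'M[K]_(p + q)) (f : {linear 'M[K]_(p + q) -> g}) : Prop :=
  [/\ forall y, exists2 X, S X & f X = y,
      forall X, S X -> (f X = 0 <-> N X),
      forall b X, S X -> mxhom b X -> lhom G b (f X)
    & forall a b X Y, S X -> S Y -> mxhom a X -> mxhom b Y ->
        br G (f X) (f Y) = f (X *m Y - (-1) ^+ (a && b) *: (Y *m X))].

End Matrices.

Definition gram_symplectic (K : fieldType) (l : nat) : 'M[K]_(l + l) :=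
  block_mx 0 1%:M (- 1%:M) 0.

(* g = A(p-1, q-1) = sl(p|q) modulo its scalar matrices (which are zero when
   p <> q, up to characteristic), and sigma = - superadjoint for diag(1, J). *)
Definition type_A_automorphism (K : fieldType) (p q : nat) (J : 'M[K]_q)
    (g : lmodType K) (G : lieSuper g) (sigma : g -> g) : Prop :=
  exists f : {linear 'M[K]_(p + q) -> g},
    mx_presentation G [set X | supertrace X = 0]
      [set X | exists a : K, X = a%:M] f /\
    forall X, supertrace X = 0 -> sigma (f X) = f (minus_superadjoint J X).

Definition reflection_mx (K : fieldType) (p q : nat) : 'M[K]_(p.+1 + q) :=
  block_mx (diag_mx (\row_j (if j == ord0 then -1 else 1))) 0 0 1%:M.

(* g = D(k+1, l) = osp(2k+2|2l), and sigma is the conjugation by a reflection. *)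
Definition type_D_automorphism (K : fieldType) (k l : nat)
    (g : lmodType K) (G : lieSuper g) (sigma : g -> g) : Prop :=
  let osp := [set X : 'M[K]_(k.*2.+2 + (l + l)) |
                minus_superadjoint (gram_symplectic K l) X = X] in
  exists f : {linear 'M[K]_(k.*2.+2 + (l + l)) -> g},
    mx_presentation G osp [set 0] f /\
    forall X, osp X ->
      sigma (f X) = f (reflection_mx K k.*2.+1 (l + l) *m X *m
                       reflection_mx K k.*2.+1 (l + l)).

Definition loop_space (K : fieldType) (g : lmodType K) (sigma : g -> g)
    (zeta : K) (j : int) : set g :=
  [set x | sigma x = zeta ^ j *: x].

(* A realization of L as the direct sum of the g^[j] (x) t^j (j in Z), K c and
   K d, where g^[j] is the zeta^j-eigenspace of sigma; loop j x stands for
   x (x) t^j and is only meaningful for x in g^[j]. *)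
Record affinization (K : fieldType) (L : lmodType K) (LL : lieSuper L) :=
  Affinization {
  fin_space : vectType K;
  fin_alg : lieSuper fin_space;
  kappa : fin_space -> fin_space -> K;
  sigma : {linear fin_space -> fin_space};
  sigma_order : nat;
  zeta : K;
  loop : int -> fin_space -> L;
  central : L;
  derivation : L;
  kappa_form : invariant_form fin_alg kappa;
  sigma_hom : forall b x, lhom fin_alg b x -> lhom fin_alg b (sigma x);
  sigma_br : forall x y,
    sigma (br fin_alg x y) = br fin_alg (sigma x) (sigma y);
  sigma_kappa : forall x y, kappa (sigma x) (sigma y) = kappa x y;
  sigma_finite : forall x, iter sigma_order sigma x = x;
  zeta_root : sigma_order.-primitive_root zeta;
  loop_linear : forall j a x y, loop j (a *: x + y) = a *: loop j x + loop j y;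
  loop_span : forall z, exists (s : seq int) (x : int -> fin_space) (r e : K),
    (forall j, loop_space sigma zeta j (x j)) /\
    z = \sum_(j <- s) loop j (x j) + r *: central + e *: derivation;
  loop_free : forall (s : seq int) (x : int -> fin_space) (r e : K),
    uniq s -> (forall j, loop_space sigma zeta j (x j)) ->
    \sum_(j <- s) loop j (x j) + r *: central + e *: derivation = 0 ->
    [/\ forall j, j \in s -> x j = 0, r = 0 & e = 0];
  loop_hom : forall b j x, loop_space sigma zeta j x -> lhom fin_alg b x ->
    lhom LL b (loop j x);
  central_even : lhom LL false central;
  derivation_even : lhom LL false derivation;
  loop_br : forall i j x y,
    loop_space sigma zeta i x -> loop_space sigma zeta j y ->
    br LL (loop i x) (loop j y) =
    loop (i + j) (br fin_alg x y) +
    (if i + j == 0 then (i%:~R * kappa x y) *: central else 0);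
  central_br : forall z, br LL central z = 0;
  derivation_br : forall j y, loop_space sigma zeta j y ->
    br LL derivation (loop j y) = j%:~R *: loop j y
}.

Arguments kappa {K L LL} _.
Arguments loop {K L LL} _.

Section AffineTypes.
Variables (K : fieldType) (L : lmodType K) (LL : lieSuper L).
Implicit Type A : affinization LL.

Definition untwisted A : Prop :=
  sigma_order A = 1%N /\ basic_classical (fin_alg A).

(* A(2k, 2l-1)^(2) *)
Definition type_A2_even_odd (k l : nat) A : Prop :=
  sigma_order A = 2%N /\
  @type_A_automorphism K k.*2.+1 (l + l) (gram_symplectic K l) _
    (fin_alg A) (sigma A).

(* A(2k-1, 2l-1)^(2) *)
Definition type_A2_odd_odd (k l : nat) A : Prop :=
  sigma_order A = 2%N /\
  @type_A_automorphism K k.*2 (l + l) (gram_symplectic K l) _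
    (fin_alg A) (sigma A).

(* A(2k, 2l)^(4) *)
Definition type_A4 (k l : nat) A : Prop :=
  sigma_order A = 4%N /\
  @type_A_automorphism K k.*2.+1 l.*2.+1 1%:M _ (fin_alg A) (sigma A).

(* D(k+1, l)^(2) *)
Definition type_D2 (k l : nat) A : Prop :=
  sigma_order A = 2%N /\
  @type_D_automorphism K k l _ (fin_alg A) (sigma A).

(* The twisted affinizations of simple Lie algebras are omitted: they have zero
   odd part. *)
Definition affine_lieSuper A : Prop :=
  [\/ untwisted A,
      exists k l, (1 <= l)%N /\ type_A2_even_odd k l A,
      exists k l, [/\ (1 <= k)%N, (1 <= l)%N, (k, l) <> (1, 1)%N
                    & type_A2_odd_odd k l A]
    | (exists k l, (k, l) <> (0, 0)%N /\ type_A4 k l A) \/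
      (exists k l, (1 <= l)%N /\ type_D2 k l A)].

(* H is a Cartan subalgebra of the even part of the fixed points of sigma. *)
Definition fin_cartan A (H : {vspace fin_space A}) : Prop :=
  [/\ forall x, x \in H -> sigma A x = x /\ lhom (fin_alg A) false x,
      forall x y, x \in H -> y \in H -> br (fin_alg A) x y = 0,
      forall x, x \in H -> forall y, exists n (e : 'I_n -> fin_space A)
        (a : 'I_n -> K),
        y = \sum_i e i /\ forall i, br (fin_alg A) x (e i) = a i *: e i
    & forall y, sigma A y = y -> lhom (fin_alg A) false y ->
        (forall x, x \in H -> br (fin_alg A) x y = 0) -> y \in H].

End AffineTypes.

(* The Cartan subalgebra h = H (x) 1 + K c + K d of L and its dual space. *)
Definition cartan (K : fieldType) (g : vectType K) (H : {vspace g}) :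
    vectType K :=
  (subvs_of H * K^o * K^o)%type.

Definition cartan_dual (K : fieldType) (g : vectType K) (H : {vspace g}) :
    vectType K :=
  'Hom(cartan H, K^o).

Section Roots.
Variables (K : fieldType) (L : lmodType K) (LL : lieSuper L).
Variables (A : affinization LL) (H : {vspace fin_space A}).
Implicit Types (la mu al : cartan_dual H) (a b : cartan H).

Definition cartan_in a : L :=
  loop A 0 (vsval a.1.1) + a.1.2 *: central A + a.2 *: derivation A.

Definition cartan_form a b : K :=
  kappa A (vsval a.1.1) (vsval b.1.1) + a.1.2 * b.2 + a.2 * b.1.2.

(* The vector representing la for cartan_form. *)
Definition cartan_vector la : cartan H :=
  xget 0 [set a | forall b, cartan_form a b = la b].

Definition dual_form la mu : K :=
  cartan_form (cartan_vector la) (cartan_vector mu).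

Definition root_space al : set L :=
  [set x | forall a, br LL (cartan_in a) x = al a *: x].

Definition root al : Prop := exists x, root_space al x /\ x <> 0.

Definition parity_root (i : bool) al : Prop :=
  exists x, [/\ root_space al x, lhom LL i x & x <> 0].

Definition real_root al : Prop := root al /\ dual_form al al <> 0.

Definition root_lattice la : Prop :=
  exists n (al : 'I_n -> cartan_dual H) (z : 'I_n -> int),
    (forall i, root (al i)) /\ la = \sum_i al i *~ z i.

End Roots.

Section WeightModules.
Variables (K : fieldType) (L : lmodType K) (LL : lieSuper L).
Variables (A : affinization LL) (H : {vspace fin_space A}).
Variables (M : lmodType K) (MM : superModule LL M).
Implicit Types la al : cartan_dual H.

Definition weight_space la : set M :=
  [set v | forall a : cartan H, act MM (cartan_in a) v = la a *: v].

(* The sum of the weight spaces is always direct. *)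
Definition weight_module : Prop :=
  forall v, exists n (la : 'I_n -> cartan_dual H) (w : 'I_n -> M),
    (forall i, weight_space (la i) (w i)) /\ v = \sum_i w i.

Definition support la : Prop := exists v, weight_space la v /\ v <> 0.

Definition dim_le (P : set M) (n : nat) : Prop :=
  exists e : 'I_n -> M, forall v, P v -> exists a : 'I_n -> K,
    v = \sum_i a i *: e i.

Definition finite_weight_module : Prop :=
  weight_module /\ forall la, exists n, dim_le (weight_space la) n.

Definition admissible : Prop :=
  [/\ finite_weight_module,
      exists n, forall la, dim_le (weight_space la) n
    & exists mu, forall la, support la -> root_lattice (la - mu)].

Definition level_zero : Prop := forall v, act MM (central A) v = 0.

Definition R_in al : Prop :=
  real_root al /\
  forall x, root_space al x -> x <> 0 -> injective (act MM x).

Definition R_ln al : Prop :=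
  real_root al /\
  forall x, root_space al x -> x <> 0 ->
    forall v, exists n, iter n (act MM x) v = 0.

End WeightModules.

Inductive ring_term (X : Type) : Type :=
  | Gen of X
  | Zero
  | One
  | Opp of ring_term X
  | Add of ring_term X & ring_term X
  | Mul of ring_term X & ring_term X.
Arguments Zero {X}.
Arguments One {X}.

Section PresentedRing.
Variables (X : Type) (rel : ring_term X -> ring_term X -> Prop).
Local Notation term := (ring_term X).

Inductive ring_cong : term -> term -> Prop :=
  | rc_rel s t : rel s t -> ring_cong s t
  | rc_refl t : ring_cong t t
  | rc_sym s t : ring_cong s t -> ring_cong t s
  | rc_trans s t u : ring_cong s t -> ring_cong t u -> ring_cong s u
  | rc_opp s t : ring_cong s t -> ring_cong (Opp s) (Opp t)
  | rc_add s s' t t' : ring_cong s s' -> ring_cong t t' ->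
      ring_cong (Add s t) (Add s' t')
  | rc_mul s s' t t' : ring_cong s s' -> ring_cong t t' ->
      ring_cong (Mul s t) (Mul s' t')
  | rc_addA s t u : ring_cong (Add s (Add t u)) (Add (Add s t) u)
  | rc_addC s t : ring_cong (Add s t) (Add t s)
  | rc_add0 t : ring_cong (Add Zero t) t
  | rc_addN t : ring_cong (Add (Opp t) t) Zero
  | rc_mulA s t u : ring_cong (Mul s (Mul t u)) (Mul (Mul s t) u)
  | rc_mul1l t : ring_cong (Mul One t) t
  | rc_mul1r t : ring_cong (Mul t One) t
  | rc_mulDl s t u : ring_cong (Mul (Add s t) u) (Add (Mul s u) (Mul t u))
  | rc_mulDr s t u : ring_cong (Mul s (Add t u)) (Add (Mul s t) (Mul s u)).

HB.instance Definition _ := gen_eqMixin term.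
HB.instance Definition _ := gen_choiceMixin term.

Definition ring_congb (s t : term) : bool := `[< ring_cong s t >].

Lemma ring_congb_equiv : equiv_class_of ring_congb.
Proof.
split=> [t|s t|t s u].
- exact/asboolP/rc_refl.
- by apply/asboolP/asboolP => /rc_sym.
- by move=> /asboolP st /asboolP tu; apply/asboolP/(rc_trans st tu).
Qed.

Canonical ring_cong_rel := EquivRelPack ring_congb_equiv.

Definition presented_ring : Type := {eq_quot ring_congb}.

HB.instance Definition _ := Choice.on presented_ring.
HB.instance Definition _ := EqQuotient.on presented_ring.

Definition pr_class (t : term) : presented_ring := \pi_presented_ring t.

Lemma pr_classP s t : ring_cong s t <-> pr_class s = pr_class t.
Proof.
split=> [st|/eqmodP st]; last by apply/asboolP.
by apply/eqmodP/asboolP.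
Qed.

Lemma pr_class_repr u : pr_class (repr u) = u.
Proof. exact: reprK. Qed.

Lemma repr_pr_class t : ring_cong (repr (pr_class t)) t.
Proof. by apply/pr_classP; rewrite pr_class_repr. Qed.

Definition pr_opp (u : presented_ring) := pr_class (Opp (repr u)).
Definition pr_add (u v : presented_ring) := pr_class (Add (repr u) (repr v)).
Definition pr_mul (u v : presented_ring) := pr_class (Mul (repr u) (repr v)).

Lemma pr_oppE t : pr_opp (pr_class t) = pr_class (Opp t).
Proof. by apply/pr_classP/rc_opp/repr_pr_class. Qed.

Lemma pr_addE s t : pr_add (pr_class s) (pr_class t) = pr_class (Add s t).
Proof. by apply/pr_classP/rc_add; apply/repr_pr_class. Qed.

Lemma pr_mulE s t : pr_mul (pr_class s) (pr_class t) = pr_class (Mul s t).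
Proof. by apply/pr_classP/rc_mul; apply/repr_pr_class. Qed.

Lemma pr_ind (P : presented_ring -> Prop) :
  (forall t, P (pr_class t)) -> forall u, P u.
Proof. by move=> Pt u; rewrite -(pr_class_repr u). Qed.

Let prE := (pr_oppE, pr_addE, pr_mulE).

Lemma pr_addA : associative pr_add.
Proof.
by do 3!elim/pr_ind=> ?; rewrite !prE; apply/pr_classP/rc_addA.
Qed.
Lemma pr_addC : commutative pr_add.
Proof. by do 2!elim/pr_ind=> ?; rewrite !prE; apply/pr_classP/rc_addC. Qed.
Lemma pr_add0 : left_id (pr_class Zero) pr_add.
Proof. by elim/pr_ind=> ?; rewrite !prE; apply/pr_classP/rc_add0. Qed.
Lemma pr_addN : left_inverse (pr_class Zero) pr_opp pr_add.
Proof. by elim/pr_ind=> ?; rewrite !prE; apply/pr_classP/rc_addN. Qed.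

HB.instance Definition _ :=
  GRing.isZmodule.Build presented_ring pr_addA pr_addC pr_add0 pr_addN.

Lemma pr_mulA : associative pr_mul.
Proof.
by do 3!elim/pr_ind=> ?; rewrite !prE; apply/pr_classP/rc_mulA.
Qed.
Lemma pr_mul1l : left_id (pr_class One) pr_mul.
Proof. by elim/pr_ind=> ?; rewrite !prE; apply/pr_classP/rc_mul1l. Qed.
Lemma pr_mul1r : right_id (pr_class One) pr_mul.
Proof. by elim/pr_ind=> ?; rewrite !prE; apply/pr_classP/rc_mul1r. Qed.
Lemma pr_mulDl : left_distributive pr_mul pr_add.
Proof.
by do 3!elim/pr_ind=> ?; rewrite !prE; apply/pr_classP/rc_mulDl.
Qed.
Lemma pr_mulDr : right_distributive pr_mul pr_add.
Proof.
by do 3!elim/pr_ind=> ?; rewrite !prE; apply/pr_classP/rc_mulDr.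
Qed.

HB.instance Definition _ := GRing.Zmodule_isPzRing.Build presented_ring
  pr_mulA pr_mul1l pr_mul1r pr_mulDl pr_mulDr.

Lemma pr_class_add s t : pr_class (Add s t) = pr_class s + pr_class t.
Proof. by rewrite -pr_addE. Qed.
Lemma pr_class_opp t : pr_class (Opp t) = - pr_class t.
Proof. by rewrite -pr_oppE. Qed.
Lemma pr_class_mul s t : pr_class (Mul s t) = pr_class s * pr_class t.
Proof. by rewrite -pr_mulE. Qed.

End PresentedRing.

Section Enveloping.
Variables (K : fieldType) (L : lmodType K) (LL : lieSuper L).

(* Generators: inl x for x in L, inr k for the scalar k. *)
Inductive env_rel : ring_term (L + K) -> ring_term (L + K) -> Prop :=
  | er_cst1 : env_rel (Gen (inr 1)) One
  | er_cstD k l : env_rel (Gen (inr (k + l))) (Add (Gen (inr k)) (Gen (inr l)))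
  | er_cstM k l : env_rel (Gen (inr (k * l))) (Mul (Gen (inr k)) (Gen (inr l)))
  | er_cstC k x :
      env_rel (Mul (Gen (inr k)) (Gen (inl x))) (Mul (Gen (inl x)) (Gen (inr k)))
  | er_genD x y : env_rel (Gen (inl (x + y))) (Add (Gen (inl x)) (Gen (inl y)))
  | er_genZ k x : env_rel (Gen (inl (k *: x))) (Mul (Gen (inr k)) (Gen (inl x)))
  | er_br a b x y : lhom LL a x -> lhom LL b y ->
      env_rel (Gen (inl (br LL x y)))
        (Add (Mul (Gen (inl x)) (Gen (inl y)))
             (Opp (Mul (Gen (inr ((-1) ^+ (a && b))))
                       (Mul (Gen (inl y)) (Gen (inl x)))))).

Definition enveloping : pzRingType := presented_ring env_rel.

Definition env_cst (k : K) : enveloping := pr_class env_rel (Gen (inr k)).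
Definition env_gen (x : L) : enveloping := pr_class env_rel (Gen (inl x)).

Inductive env_hom : bool -> set enveloping :=
  | eh_0 b : env_hom b 0
  | eh_add b u v : env_hom b u -> env_hom b v -> env_hom b (u + v)
  | eh_cst k : env_hom false (env_cst k)
  | eh_gen b x : lhom LL b x -> env_hom b (env_gen x)
  | eh_mul a b u v : env_hom a u -> env_hom b v -> env_hom (a (+) b) (u * v).

Variables (M : lmodType K) (MM : superModule LL M).

Fixpoint term_act (t : ring_term (L + K)) (m : M) : M :=
  match t with
  | Gen (inl x) => act MM x m
  | Gen (inr k) => k *: m
  | Zero => 0
  | One => m
  | Opp s => - term_act s m
  | Add s t => term_act s m + term_act t m
  | Mul s t => term_act s (term_act t m)
  end.

Lemma actDr x : {morph act MM x : m n / m + n}.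
Proof.
by move=> m n; rewrite -[m]scale1r (act_bilinear MM).2 !scale1r.
Qed.

Lemma act0r x : act MM x 0 = 0.
Proof. by apply: (@addrI _ (act MM x 0)); rewrite -actDr !addr0. Qed.

Lemma actZr x k m : act MM x (k *: m) = k *: act MM x m.
Proof. by rewrite -[k *: m]addr0 (act_bilinear MM).2 act0r !addr0. Qed.

Lemma actDl x y m : act MM (x + y) m = act MM x m + act MM y m.
Proof. by rewrite -[x]scale1r (act_bilinear MM).1 !scale1r. Qed.

Lemma act0l m : act MM 0 m = 0.
Proof. by apply: (@addrI _ (act MM 0 m)); rewrite -actDl !addr0. Qed.

Lemma actZl k x m : act MM (k *: x) m = k *: act MM x m.
Proof. by rewrite -[k *: x]addr0 (act_bilinear MM).1 act0l !addr0. Qed.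

Lemma term_actD t : {morph term_act t : m n / m + n}.
Proof.
elim: t => [[x|k]|||s IHs|s IHs t IHt|s IHs t IHt] m n //=.
- exact: actDr.
- exact: scalerDr.
- by rewrite addr0.
- by rewrite IHs opprD.
- by rewrite IHs IHt addrACA.
- by rewrite IHt IHs.
Qed.

Lemma term_act_cong s t : ring_cong env_rel s t -> term_act s =1 term_act t.
Proof.
elim=> {s t} //=.
- move=> s t; case=> [|k l|k l|k x|x y|k x|a b x y hx hy] m /=.
  + by rewrite scale1r.
  + by rewrite scalerDl.
  + by rewrite scalerA.
  + by rewrite actZr.
  + by rewrite actDl.
  + by rewrite actZl.
  + exact: act_br hx hy.
- by move=> s t _ IH m; rewrite IH.
- by move=> s t u _ IHst _ IHtu m; rewrite IHst IHtu.
- by move=> s t _ IH m; rewrite IH.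
- by move=> s s' t t' _ IHs _ IHt m; rewrite IHs IHt.
- by move=> s s' t t' _ IHs _ IHt m; rewrite IHt IHs.
- by move=> s t u m; rewrite addrA.
- by move=> s t m; rewrite addrC.
- by move=> t m; rewrite add0r.
- by move=> t m; rewrite addNr.
- by move=> s t u m; rewrite term_actD.
Qed.

(* M viewed as a module over the enveloping algebra. *)
Definition env_module of superModule LL M : Type := M.
Local Notation EM := (env_module MM).

HB.instance Definition _ := GRing.Zmodule.on EM.

Definition env_act (u : enveloping) (m : EM) : EM := term_act (repr u) m.

Lemma env_actE t m : env_act (pr_class env_rel t) m = term_act t m.
Proof. exact/term_act_cong/repr_pr_class. Qed.

Lemma env_actA u v m : env_act u (env_act v m) = env_act (u * v) m.
Proof.
elim/pr_ind: u m => s m; elim/pr_ind: v => t.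
by rewrite -pr_class_mul !env_actE.
Qed.

Lemma env_act1 : left_id 1 env_act.
Proof. by move=> m; rewrite (env_actE One). Qed.

Lemma env_actDr : right_distributive env_act +%R.
Proof. by move=> u m n; apply: term_actD. Qed.

Lemma env_actDl m : {morph env_act^~ m : u v / u + v}.
Proof.
elim/pr_ind=> s; elim/pr_ind=> t.
by rewrite -pr_class_add !env_actE.
Qed.

HB.instance Definition _ := GRing.Zmodule_isLmodule.Build enveloping EM
  env_actA env_act1 env_actDr env_actDl.

End Enveloping.

(* localization s is the universal ring over B in which s is invertible; it is
   the Ore localization when the powers of s form an Ore set. *)

Section Localization.
Variables (B : pzRingType) (s : B).

(* Generators: Some b for b in B, None for the inverse of s. *)
Inductive loc_rel : ring_term (option B) -> ring_term (option B) -> Prop :=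
  | lr_1 : loc_rel (Gen (Some 1)) One
  | lr_D x y :
      loc_rel (Gen (Some (x + y))) (Add (Gen (Some x)) (Gen (Some y)))
  | lr_M x y :
      loc_rel (Gen (Some (x * y))) (Mul (Gen (Some x)) (Gen (Some y)))
  | lr_invl : loc_rel (Mul (Gen None) (Gen (Some s))) One
  | lr_invr : loc_rel (Mul (Gen (Some s)) (Gen None)) One.

Definition localization : pzRingType := presented_ring loc_rel.

Definition loc_in (b : B) : localization := pr_class loc_rel (Gen (Some b)).
Definition loc_inv : localization := pr_class loc_rel (Gen None).

Lemma loc_in_additive : zmod_morphism loc_in.
Proof.
have locD x y : loc_in (x + y) = loc_in x + loc_in y.
  by rewrite /loc_in -pr_class_add; apply/pr_classP/rc_rel/lr_D.
by move=> x y; apply: (addIr (loc_in y)); rewrite -locD !subrK.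
Qed.

Lemma loc_in_multiplicative : monoid_morphism loc_in.
Proof.
split; first exact/pr_classP/rc_rel/lr_1.
by move=> x y; rewrite /loc_in -pr_class_mul; apply/pr_classP/rc_rel/lr_M.
Qed.

HB.instance Definition _ :=
  GRing.isZmodMorphism.Build B localization loc_in loc_in_additive.
HB.instance Definition _ :=
  GRing.isMonoidMorphism.Build B localization loc_in loc_in_multiplicative.

End Localization.

(* tensor j N is the left S-module S (x)_B N, for S a right B-module through
   j. *)

Inductive tensor_term (S N : Type) : Type :=
  | Tens of S & N
  | TZero
  | TAdd of tensor_term S N & tensor_term S N.
Arguments TZero {S N}.

Section Tensor.
Variables (B S : pzRingType) (j : {rmorphism B -> S}) (N : lmodType B).
Local Notation term := (tensor_term S N).

Inductive tensor_cong : term -> term -> Prop :=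
  | tc_refl t : tensor_cong t t
  | tc_sym t u : tensor_cong t u -> tensor_cong u t
  | tc_trans t u v : tensor_cong t u -> tensor_cong u v -> tensor_cong t v
  | tc_add t t' u u' : tensor_cong t t' -> tensor_cong u u' ->
      tensor_cong (TAdd t u) (TAdd t' u')
  | tc_addA t u v : tensor_cong (TAdd t (TAdd u v)) (TAdd (TAdd t u) v)
  | tc_addC t u : tensor_cong (TAdd t u) (TAdd u t)
  | tc_add0 t : tensor_cong (TAdd TZero t) t
  | tc_tensDl a b n :
      tensor_cong (Tens (a + b) n) (TAdd (Tens a n) (Tens b n))
  | tc_tensDr a m n :
      tensor_cong (Tens a (m + n)) (TAdd (Tens a m) (Tens a n))
  | tc_tens0l n : tensor_cong (Tens 0 n) TZero
  | tc_tens_balanced a b n :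
      tensor_cong (Tens (a * j b) n) (Tens a (b *: n)).

HB.instance Definition _ := gen_eqMixin term.
HB.instance Definition _ := gen_choiceMixin term.

Definition tensor_congb (t u : term) : bool := `[< tensor_cong t u >].

Lemma tensor_congb_equiv : equiv_class_of tensor_congb.
Proof.
split=> [t|t u|u t v].
- exact/asboolP/tc_refl.
- by apply/asboolP/asboolP => /tc_sym.
- by move=> /asboolP tu /asboolP uv; apply/asboolP/(tc_trans tu uv).
Qed.

Canonical tensor_cong_rel := EquivRelPack tensor_congb_equiv.

Definition tensor : Type := {eq_quot tensor_congb}.

HB.instance Definition _ := Choice.on tensor.
HB.instance Definition _ := EqQuotient.on tensor.

Definition ts_class (t : term) : tensor := \pi_tensor t.

Lemma ts_classP t u : tensor_cong t u <-> ts_class t = ts_class u.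
Proof.
split=> [tu|/eqmodP tu]; last by apply/asboolP.
by apply/eqmodP/asboolP.
Qed.

Lemma ts_class_repr u : ts_class (repr u) = u.
Proof. exact: reprK. Qed.

Lemma repr_ts_class t : tensor_cong (repr (ts_class t)) t.
Proof. by apply/ts_classP; rewrite ts_class_repr. Qed.

Fixpoint tscale_term (a : S) (t : term) : term :=
  match t with
  | Tens b n => Tens (a * b) n
  | TZero => TZero
  | TAdd t u => TAdd (tscale_term a t) (tscale_term a u)
  end.

Lemma tscale_cong a t u :
  tensor_cong t u -> tensor_cong (tscale_term a t) (tscale_term a u).
Proof.
elim=> {t u} /=; try by move=> *; constructor.
- by move=> t u v _ IHtu _ IHuv; apply: tc_trans IHtu IHuv.
- by move=> b c n; rewrite mulrDr; apply: tc_tensDl.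
- by move=> n; rewrite mulr0; apply: tc_tens0l.
- by move=> b c n; rewrite mulrA; apply: tc_tens_balanced.
Qed.

Definition ts_add (u v : tensor) := ts_class (TAdd (repr u) (repr v)).
Definition ts_scale (a : S) (u : tensor) := ts_class (tscale_term a (repr u)).
Definition ts_opp := ts_scale (- 1).

Lemma ts_addE t u : ts_add (ts_class t) (ts_class u) = ts_class (TAdd t u).
Proof. by apply/ts_classP/tc_add; apply/repr_ts_class. Qed.

Lemma ts_scaleE a t : ts_scale a (ts_class t) = ts_class (tscale_term a t).
Proof. by apply/ts_classP/tscale_cong/repr_ts_class. Qed.

Lemma ts_ind (P : tensor -> Prop) :
  (forall t, P (ts_class t)) -> forall u, P u.
Proof. by move=> Pt u; rewrite -(ts_class_repr u). Qed.

Let tsE := (ts_addE, ts_scaleE).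

Lemma ts_addA : associative ts_add.
Proof.
by do 3!elim/ts_ind=> ?; rewrite !tsE; apply/ts_classP/tc_addA.
Qed.
Lemma ts_addC : commutative ts_add.
Proof. by do 2!elim/ts_ind=> ?; rewrite !tsE; apply/ts_classP/tc_addC. Qed.
Lemma ts_add0 : left_id (ts_class TZero) ts_add.
Proof. by elim/ts_ind=> ?; rewrite !tsE; apply/ts_classP/tc_add0. Qed.

Lemma tscale_term1 t : tscale_term 1 t = t.
Proof. by elim: t => //= [a n|t -> u ->//]; rewrite mul1r. Qed.

Lemma tscale_termA a b t :
  tscale_term a (tscale_term b t) = tscale_term (a * b) t.
Proof. by elim: t => //= [c n|t -> u ->//]; rewrite mulrA. Qed.

Lemma tscale_termD a b t :
  tensor_cong (tscale_term (a + b) t) (TAdd (tscale_term a t) (tscale_term b t)).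
Proof.
elim: t => /= [c n||t IHt u IHu].
- by rewrite mulrDl; apply: tc_tensDl.
- exact/tc_sym/tc_add0.
- apply/ts_classP; have /ts_classP -> := tc_add IHt IHu.
  rewrite -!ts_addE -!ts_addA; congr ts_add.
  by rewrite !ts_addA; congr ts_add; rewrite ts_addC.
Qed.

Lemma tscale_term0 t : tensor_cong (tscale_term 0 t) TZero.
Proof.
elim: t => /= [c n||t IHt u IHu]; first by rewrite mul0r; apply: tc_tens0l.
- exact: tc_refl.
- exact: tc_trans (tc_add IHt IHu) (tc_add0 _).
Qed.

Lemma ts_addN : left_inverse (ts_class TZero) ts_opp ts_add.
Proof.
elim/ts_ind=> t; rewrite /ts_opp !tsE -{2}[t]tscale_term1.
have /ts_classP <- := tscale_termD (- 1) 1 t; rewrite addNr.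
exact/ts_classP/tscale_term0.
Qed.

HB.instance Definition _ :=
  GRing.isZmodule.Build tensor ts_addA ts_addC ts_add0 ts_addN.

Lemma ts_scaleA a b u : ts_scale a (ts_scale b u) = ts_scale (a * b) u.
Proof. by elim/ts_ind: u => t; rewrite !tsE tscale_termA. Qed.
Lemma ts_scale1 : left_id 1 ts_scale.
Proof. by elim/ts_ind=> t; rewrite !tsE tscale_term1. Qed.
Lemma ts_scaleDr : right_distributive ts_scale +%R.
Proof.
move=> a; elim/ts_ind=> t; elim/ts_ind=> u.
by rewrite [_ + _]ts_addE [RHS]/+%R /= !tsE.
Qed.
Lemma ts_scaleDl u : {morph ts_scale^~ u : a b / a + b}.
Proof.
elim/ts_ind: u => t a b.
by rewrite [RHS]/+%R /= !tsE; apply/ts_classP/tscale_termD.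
Qed.

HB.instance Definition _ := GRing.Zmodule_isLmodule.Build S tensor
  ts_scaleA ts_scale1 ts_scaleDr ts_scaleDl.

Definition tens (a : S) (n : N) : tensor := ts_class (Tens a n).

End Tensor.

Definition binomial_coef (K : fieldType) (x : K) (i : nat) : K :=
  \prod_(j < i) (x - j%:R) / i`!%:R.

Section TwistedLocalization.
Variables (K : fieldType) (L : lmodType K) (LL : lieSuper L) (f : L).

Definition env_loc : pzRingType := localization (env_gen LL f).

Definition env_loc_in : {rmorphism enveloping LL -> env_loc} :=
  loc_in (env_gen LL f).

Definition env_loc_cst (k : K) : env_loc := env_loc_in (env_cst LL k).
Definition env_loc_gen (x : L) : env_loc := env_loc_in (env_gen LL x).
Definition env_loc_inv : env_loc := loc_inv (env_gen LL f).

(* The grading for which the inverse of f, like f, is even. *)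
Inductive env_loc_hom : bool -> set env_loc :=
  | elh_0 b : env_loc_hom b 0
  | elh_add b u v : env_loc_hom b u -> env_loc_hom b v -> env_loc_hom b (u + v)
  | elh_in b u : env_hom b u -> env_loc_hom b (env_loc_in u)
  | elh_inv : env_loc_hom false env_loc_inv
  | elh_mul a b u v :
      env_loc_hom a u -> env_loc_hom b v -> env_loc_hom (a (+) b) (u * v).

Definition ad_f (u : env_loc) : env_loc :=
  env_loc_gen f * u - u * env_loc_gen f.

(* A sum with finitely many nonzero terms as soon as ad f is locally
   nilpotent. *)
Definition Theta (x : K) (u : env_loc) : env_loc :=
  \sum_(i \in [set: nat])
    env_loc_cst (binomial_coef x i) * iter i ad_f u * env_loc_inv ^+ i.

Variables (N : lmodType K) (NN : superModule LL N).

Definition localized_module : lmodType env_loc :=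
  tensor env_loc_in (env_module NN).

Inductive localized_hom : bool -> set localized_module :=
  | loh_0 b : localized_hom b 0
  | loh_add b v w : localized_hom b v -> localized_hom b w ->
      localized_hom b (v + w)
  | loh_tens a b u n : env_loc_hom a u -> mhom NN b n ->
      localized_hom (a (+) b) (tens env_loc_in u (n : env_module NN)).

(* M is isomorphic, as a graded L-module, to the localized module of N on which
   u acts as Theta x u. *)
Definition iso_twisted (M : lmodType K) (MM : superModule LL M) (x : K) :
    Prop :=
  exists phi : M -> localized_module,
    [/\ bijective phi,
        forall k m n, phi (k *: m + n) = env_loc_cst k *: phi m + phi n,
        forall y m, phi (act MM y m) = Theta x (env_loc_gen y) *: phi m
      & forall b m, mhom MM b m -> localized_hom b (phi m)].

End TwistedLocalization.

Definition twisted_localization_using (K : fieldType) (L : lmodType K)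
    (LL : lieSuper L) (A : affinization LL) (H : {vspace fin_space A})
    (M : lmodType K) (MM : superModule LL M)
    (N : lmodType K) (NN : superModule LL N) (x : K) : Prop :=
  exists (al : cartan_dual H) (f : L),
    [/\ parity_root false al, real_root al,
        [/\ f <> 0, lhom LL false f & root_space al f]
      & iso_twisted f NN MM x].

(* Main.v *)
(* Let f and e be opposite root vectors for - al and al, with h = [e, f] in the
   Cartan subalgebra and al(h) = 2. Both act injectively on M, whose weight
   spaces are finite dimensional, so f acts bijectively and D_al(M) = M. For
   every x the operators sum_i binom(x, i) (ad f)^i(y) f^-i define an action of
   L on the space M: the identities to be checked are polynomial in x, and for
   x = n in nat the sum is f^n y f^-n. If w is an eigenvector of e f in a weight
   space of M, then e kills f w in the x-twisted module for a root x of a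
   quadratic equation.

   Omega is the intersection of all nonzero graded submodules N of this twisted
   module. It is nonzero: M is simple, so each vector is sent into N by a power
   of f, and on an al-string the operator e is injective far enough in the
   direction of - al, because there it could only vanish on eigenvectors of f e
   whose eigenvalues, on a fixed weight space, would be infinitely many; hence N
   contains a weight space independent of N. So Omega is simple, e is locally
   nilpotent on it, and M is the twist by - x of the localization of Omega.

   If a root vector of weight be is locally nilpotent on a module with finite
   dimensional weight spaces, then the be-strings of weights are bounded above:
   otherwise singular vectors would give infinitely many eigenvalues of f e on
   one weight space. Twisting only translates the support, so local nilpotency
   passes from M to Omega. *)
Require Import Defs.
From HB Require Import structures.
From mathcomp Require Import all_boot all_order all_algebra.
From mathcomp Require Import all_classical all_reals.
From mathcomp.real_closed Require Import complex.
From mathcomp Require Import ring zify.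

Set Implicit Arguments.
Unset Strict Implicit.
Unset Printing Implicit Defensive.

Import Order.TTheory GRing.Theory Num.Theory.

Local Open Scope classical_set_scope.
Local Open Scope ring_scope.

(** * Linear algebra in modules of arbitrary dimension *)

Section Subspaces.
Variables (K : fieldType) (V : lmodType K).
Implicit Types (P Q : set V) (u v w : V).

Section Closure.
Variables (P : set V) (subP : subspace P).

Lemma subspace0 : P 0. Proof. by case: subP. Qed.

Lemma subspaceZ a u : P u -> P (a *: u).
Proof.
by move=> Pu; rewrite -[_ *: _]addr0; apply: subP.2 => //; apply: subP.1.
Qed.

Lemma subspaceD u v : P u -> P v -> P (u + v).
Proof. by move=> Pu Pv; rewrite -[u]scale1r; apply: subP.2. Qed.

Lemma subspaceN u : P u -> P (- u).
Proof. by rewrite -scaleN1r; apply: subspaceZ. Qed.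

Lemma subspaceB u v : P u -> P v -> P (u - v).
Proof. by move=> Pu Pv; apply: subspaceD => //; apply: subspaceN. Qed.

Lemma subspace_sum I (r : seq I) (C : pred I) (F : I -> V) :
  (forall i, C i -> P (F i)) -> P (\sum_(i <- r | C i) F i).
Proof.
by move=> PF; apply: (big_ind P) => //; [exact: subspace0|exact: subspaceD].
Qed.

Lemma subspace_sum_mem (I : eqType) (r : seq I) (F : I -> V) :
  (forall i, i \in r -> P (F i)) -> P (\sum_(i <- r) F i).
Proof.
by move=> PF; rewrite big_seq; apply: subspace_sum.
Qed.

End Closure.

Lemma subspace_zero : subspace [set (0 : V)].
Proof. by split=> // a u v -> ->; rewrite scaler0 addr0. Qed.

Lemma subspaceI P Q : subspace P -> subspace Q -> subspace (P `&` Q).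
Proof.
move=> [P0 PD] [Q0 QD]; split=> // a u v [Pu Qu] [Pv Qv].
by split; [apply: PD|apply: QD].
Qed.

(* W indexes the eigenvalue systems: ev mu a is the eigenvalue of T a. *)
Lemma eigen_component (W : eqType) (I : Type) (ev : W -> I -> K)
    (T : I -> {linear V -> V}) P (s : seq W) (w : W -> V) :
  (forall mu nu, (forall a, ev mu a = ev nu a) -> mu = nu) ->
  subspace P -> (forall a v, P v -> P (T a v)) -> uniq s ->
  (forall mu a, mu \in s -> T a (w mu) = ev mu a *: w mu) ->
  P (\sum_(mu <- s) w mu) -> forall mu, mu \in s -> P (w mu).
Proof.
move=> ev_inj subP TP; elim: s w => [//|mu0 s IHs] w /= /andP[mu0s us] Tw.
rewrite big_cons => Pw.
have Ps mu : mu \in s -> P (w mu).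
  (* Some T a separates mu from mu0: T a - ev mu0 a kills the first term and rescales the others, to
     which the induction hypothesis applies. *)
  move=> mus; have [a ne_a] : exists a, ev mu a <> ev mu0 a.
    apply: contrapT => nex; move: mu0s; rewrite -(ev_inj mu mu0) ?mus //.
    by move=> a; apply: contrapT => ne_a; apply: nex; exists a.
  pose w' nu := (ev nu a - ev mu0 a) *: w nu.
  have Pw' : P (\sum_(nu <- s) w' nu).
    suff -> : \sum_(nu <- s) w' nu = T a (w mu0 + \sum_(nu <- s) w nu) -
        ev mu0 a *: (w mu0 + \sum_(nu <- s) w nu).
      by apply: subspaceB => //; [apply: TP|apply: subspaceZ].
    rewrite linearD scalerDr Tw ?mem_head // opprD addrACA subrr add0r.
    rewrite linear_sum scaler_sumr -sumrB big_seq [RHS]big_seq.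
    by apply: eq_bigr => nu nus; rewrite Tw ?inE ?nus ?orbT // -scalerBl.
  have -> : w mu = (ev mu a - ev mu0 a)^-1 *: w' mu.
    rewrite /w' scalerA mulVf ?scale1r // subr_eq0; exact/eqP.
  apply: subspaceZ => //; apply: IHs => // nu b nus.
  by rewrite /w' linearZ /= Tw ?inE ?nus ?orbT // !scalerA mulrC.
move=> mu; rewrite inE => /predU1P[->|/Ps//].
rewrite -[w mu0](addrK (\sum_(mu <- s) w mu)); apply: subspaceB => //.
exact: subspace_sum_mem.
Qed.

(** Merging the terms with a common label makes the labels distinct, as [eigen_component] demands of
    its list. *)
Lemma group_sum (W : eqType) n (la : 'I_n -> W) (w : 'I_n -> V) :
  \sum_i w i =
    \sum_(mu <- undup [seq la i | i : 'I_n]) \sum_(i | la i == mu) w i.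
Proof.
rewrite (exchange_big_dep predT) //=; apply: eq_bigr => i _.
rewrite -big_filter; have -> : [seq mu <- undup [seq la i | i : 'I_n] | la i ==
  mu] = [:: la i].
  rewrite (@eq_filter _ _ (pred1 (la i))); last by move=> mu; rewrite /= eq_sym.
  by rewrite filter_pred1_uniq ?undup_uniq // mem_undup map_f // mem_enum.
by rewrite big_seq1.
Qed.

(** Eigenvectors with equal eigenvalues are merged first; distinct eigenvalues then separate the
    sums, which stay in P even when the single e i do not. *)
Lemma diagonal_decomposition (T : {linear V -> V}) P n (e : 'I_n -> V)
    (a : 'I_n -> K) :
  subspace P -> (forall v, P v -> P (T v)) ->
  (forall i, T (e i) = a i *: e i) -> P (\sum_i e i) ->
  exists s (w : K -> V), [/\ \sum_i e i = \sum_(c <- s) w c,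
    forall c, T (w c) = c *: w c & forall c, c \in s -> P (w c)].
Proof.
move=> subP TP Te; rewrite (group_sum a e) => Pe.
exists (undup [seq a i | i : 'I_n]), (fun c => \sum_(i | a i == c) e i).
have Tw c : T (\sum_(i | a i == c) e i) = c *: \sum_(i | a i == c) e i.
  by rewrite linear_sum scaler_sumr; apply: eq_bigr => i /eqP <-.
split=> //; apply: (@eigen_component _ unit (fun c _ => c) (fun=> T)) => //.
  by move=> c d /(_ tt).
exact: undup_uniq.
Qed.

(** This is p(T) v, written with iterates because V may be infinite dimensional and T then has no
    matrix. *)
Definition poly_app (T : V -> V) (p : {poly K}) v : V :=
  \sum_(i < size p) p`_i *: iter i T v.

Implicit Types p q : {poly K}.

Lemma poly_appE T p v n : (size p <= n)%N ->
  poly_app T p v = \sum_(i < n) p`_i *: iter i T v.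
Proof.
move=> len; rewrite /poly_app -!(big_mkord xpredT (fun i => p`_i *: iter i T v)).
rewrite (big_cat_nat (leq0n (size p)) len) /= [X in _ + X]big_nat.
rewrite [X in _ + X]big1 ?addr0 // => i /andP[le_i _].
by rewrite nth_default ?scale0r.
Qed.

Lemma poly_appD T p q v : poly_app T (p + q) v = poly_app T p v + poly_app T q v.
Proof.
have ls := size_polyD p q; rewrite (poly_appE T v ls).
rewrite (poly_appE T v (leq_maxl (size p) (size q))).
rewrite (poly_appE T v (leq_maxr (size p) (size q))) -big_split /=.
by apply: eq_bigr => i _; rewrite coefD scalerDl.
Qed.

Lemma poly_appZ T a p v : poly_app T (a *: p) v = a *: poly_app T p v.
Proof.
rewrite (poly_appE T v (size_scale_leq a p)) scaler_sumr.
by apply: eq_bigr => i _; rewrite coefZ scalerA.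
Qed.

Lemma poly_appC T a v : poly_app T a%:P v = a *: v.
Proof.
by rewrite (poly_appE T v (size_polyC_leq1 a)) big_ord1 coefC.
Qed.

Lemma poly_appMX T p v : poly_app T (p * 'X) v = poly_app T p (T v).
Proof.
have [->|p0] := eqVneq p 0.
  by rewrite mul0r /poly_app size_poly0 !big_ord0.
rewrite /poly_app size_mulX // big_ord_recl coefMX scale0r add0r.
by apply: eq_bigr => i _; rewrite coefMX /= -iterSr.
Qed.

Lemma poly_appMXsubC (T : {linear V -> V}) p a v :
  poly_app T (p * ('X - a%:P)) v = poly_app T p (T v - a *: v).
Proof.
have Titer i u : iter i T (u - a *: v) = iter i T u - a *: iter i T v.
  by elim: i => //= i ->; rewrite linearB linearZ.
rewrite mulrBr -mulrN -polyCN mulrC [_ * (_)%:P]mulrC mul_polyC poly_appD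
  poly_appZ.
rewrite mulrC poly_appMX /poly_app scaler_sumr -big_split /=.
by apply: eq_bigr => i _; rewrite Titer scalerBr !scalerA mulNr mulrC scaleNr.
Qed.

Lemma subspace_poly_app T P p v : subspace P -> (forall u, P u -> P (T u)) ->
  P v -> P (poly_app T p v).
Proof.
move=> subP TP Pv; apply: subspace_sum => // i _; apply: subspaceZ => //.
by elim: (nat_of_ord i) => //= j; apply: TP.
Qed.

(** The coordinates form an (n+1) by n matrix, whose left kernel is nonzero. *)
Lemma dim_le_dependent P n (v : 'I_n.+1 -> V) : dim_le P n ->
  (forall i, P (v i)) ->
  exists2 c : 'I_n.+1 -> K, (exists i, c i != 0) & \sum_i c i *: v i = 0.
Proof.
move=> [e eP] Pv; pose a i := projT1 (cid (eP _ (Pv i))).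
have va i : v i = \sum_j a i j *: e j by rewrite /a; case: cid.
pose A : 'M[K]_(n.+1, n) := \matrix_(i, j) a i j.
have : kermx A != 0.
  rewrite kermx_eq0 /row_free neq_ltn; apply/orP; left.
  by rewrite ltnS rank_leq_col.
move=> /rowV0Pn[c /sub_kermxP cA c0].
exists (fun i => c 0 i).
  by move: c0 => /eqP c0; apply/existsP; apply: contra_notT c0 => /existsPn c0;
     apply/rowP => i; rewrite mxE; apply/eqP/negPn.
under eq_bigr do rewrite va scaler_sumr.
rewrite exchange_big big1 // => j _; under eq_bigr do rewrite scalerA.
rewrite -scaler_suml; have /rowP/(_ j) := cA; rewrite !mxE => cAj.
suff -> : \sum_i c 0 i * a i j = 0 by rewrite scale0r.
rewrite -[RHS]cAj. by apply: eq_bigr => i _; rewrite mxE.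
Qed.

(** The n+1 vectors v, T v, ..., T^n v lie in the span of n vectors, so they are dependent. *)
Lemma dim_le_annihilator T P n v : dim_le P n -> (forall u, P u -> P (T u)) ->
  P v -> exists2 p : {poly K}, p != 0 & poly_app T p v = 0.
Proof.
move=> dP TP Pv.
have Piter i : P (iter i T v) by elim: i => //= i; apply: TP.
have [c [i ci] sum0] := dim_le_dependent dP (fun i : 'I_n.+1 => Piter i).
exists (\poly_(i < n.+1) c (inord i)).
  apply: contra_neq ci => /polyP/(_ i); rewrite coef_poly ltn_ord coef0.
  by rewrite inord_val.
rewrite (poly_appE T v (size_poly _ _)) -[RHS]sum0; apply: eq_bigr => j _.
by rewrite coef_poly ltn_ord inord_val.
Qed.

(* If T is injective on a finite dimensional space, then v is a combination of
   the T^i v with i > 0. *)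
Lemma dim_le_mem_image (T : {linear V -> V}) P Q n v : dim_le P n ->
  subspace P -> (forall u, P u -> P (T u)) ->
  (forall u, P u -> T u = 0 -> u = 0) ->
  subspace Q -> (forall u, Q u -> Q (T u)) -> P v -> Q (T v) -> Q v.
Proof.
move=> dP subP TP Tinj subQ TQ Pv QTv.
have [p p0] := dim_le_annihilator dP TP Pv.
elim/poly_ind: p p0 => [|p c IHp]; first by rewrite eqxx.
(* The annihilating polynomial is p X + c. If c = 0, injectivity removes the factor X; otherwise c v
   = - p(T) T v lies in Q. *)
have [->|c0 _] := eqVneq c 0; rewrite poly_appD poly_appMX poly_appC.
  rewrite addr0 scale0r addr0 => pX0.
  have p0 : p != 0 by apply: contra_neq pX0 => ->; rewrite mul0r.
  move=> pTv; apply: IHp => //; apply: Tinj; first exact: subspace_poly_app.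
  rewrite -pTv /poly_app linear_sum; apply: eq_bigr => i _.
  by rewrite linearZ /= -iterSr.
move/eqP; rewrite addrC addr_eq0 => /eqP cv.
have -> : v = c^-1 *: (c *: v) by rewrite scalerA mulVf ?scale1r.
by apply: subspaceZ => //; rewrite cv; apply: subspaceN => //;
  apply: subspace_poly_app.
Qed.

(** Eigenvectors for distinct eigenvalues are independent, so at most n of the values mu k have an
    eigenvector in P. *)
Lemma dim_le_finite_eigenvalues (T : {linear V -> V}) P n (mu : nat -> K) :
  dim_le P n -> injective mu ->
  exists n0, forall k w, (n0 <= k)%N -> P w -> T w = mu k *: w -> w = 0.
Proof.
move=> dP mu_inj; apply: contrapT => nex.
pose bad k w := [/\ P w, T w = mu k *: w & w <> 0].
have inf n0 : exists2 k, (n0 <= k)%N & exists w, bad k w.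
  apply: contrapT => nk; apply: nex; exists n0 => k w le_k Pw Tw.
  by apply: contrapT => w0; apply: nk; exists k => //; exists w.
(* Bad indices occur beyond every bound, so n+1 distinct ones can be collected. *)
have [s [ss us sbad]] : exists s : seq nat,
    [/\ size s = n.+1, uniq s & forall k, k \in s -> exists w, bad k w].
  elim: n.+1 => [|m [s [ss us sbad]]]; first by exists [::].
  have [k le_k bad_k] := inf (\max_(i <- s) i).+1.
  exists (k :: s); split=> /=; first by rewrite ss.
    rewrite us andbT; apply: contraL le_k => ks.
    by rewrite -leqNgt (big_rem k) //= leq_maxl.
  by move=> j; rewrite inE => /predU1P[->//|/sbad].
pose w k := xget 0 [set w | bad k w].
have wP k : k \in s -> bad k (w k) by move=> /sbad; apply: xgetPex.
have sk (i : 'I_n.+1) : nth 0%N s i \in s by rewrite mem_nth // ss.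
have Pw (i : 'I_n.+1) : P (w (nth 0%N s i)) by case: (wP _ (sk i)).
have [c [i ci] sum0] := dim_le_dependent dP Pw.
have [_ _] := wP _ (sk i); apply.
pose d (k : nat) := c (inord (index k s)) *: w k.
have ds (j : 'I_n.+1) : d (nth 0%N s j) = c j *: w (nth 0%N s j).
  by rewrite /d index_uniq ?ss // inord_val.
(* The vanishing combination lies in the zero subspace, hence so does each of its
   eigencomponents. *)
have : [set (0 : V)] (d (nth 0%N s i)).
  apply: (@eigen_component nat unit (fun k _ => mu k) (fun _ => T) _ s d) => //.
  - by move=> j k /(_ tt)/mu_inj.
  - exact: subspace_zero.
  - by move=> _ v /= ->; rewrite linear0.
  - move=> k _ /wP[_ Tw _]; rewrite /d linearZ /= Tw !scalerA; congr (_ *: _).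
    exact: mulrC.
  - rewrite /= (big_nth 0%N) big_mkord ss -[RHS]sum0.
    by apply: eq_bigr => j _; rewrite ds.
by rewrite ds /= => /eqP; rewrite scaler_eq0 (negPf ci) => /eqP.
Qed.

(** The family provided by [dim_le] may lie outside Q. A spanning family inside Q is needed when a
    weight space is cut down to a submodule, whose carrier is another type. Induction on n: Q meets
    the span R of the last vectors in a smaller space, and one more vector completes the family. *)
Lemma dim_le_subset P Q n : subspace Q -> Q `<=` P -> dim_le P n ->
  exists e : 'I_n -> V, (forall i, Q (e i)) /\
    forall v, Q v -> exists a : 'I_n -> K, v = \sum_i a i *: e i.
Proof.
move=> subQ QP [e eP]; have {P QP eP} : forall v, Q v ->
  exists a : 'I_n -> K, v = \sum_i a i *: e i by move=> v /QP/eP.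
elim: n e Q subQ => [|n IHn] e Q subQ eQ; first by exists e; split=> // -[].
pose R := [set v | exists a : 'I_n -> K, v = \sum_i a i *: e (lift ord0 i)].
have subR : subspace R.
  split; first by exists (fun=> 0); rewrite big1 // => i _; rewrite scale0r.
  move=> a _ _ [b ->] [c ->]; exists (fun i => a * b i + c i).
  rewrite scaler_sumr -big_split; apply: eq_bigr => i _ /=.
  by rewrite scalerDl scalerA.
have [|e' [e'QR e'P]] := IHn (fun i => e (lift ord0 i)) _ (subspaceI subQ subR).
  by move=> v [].
suff [q0 Qq0 q0P] : exists2 q0, Q q0 &
    forall u, Q u -> exists b, (Q `&` R) (u - b *: q0).
  exists (fun i => if unlift ord0 i is Some j then e' j else q0);
    split=> [i|u Qu].
    by case: unliftP => // j _; case: (e'QR j).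
  have [b /e'P[c uc]] := q0P u Qu.
  exists (fun i => if unlift ord0 i is Some j then c j else b).
  rewrite big_ord_recl unlift_none; under eq_bigr do rewrite liftK.
  by rewrite -uc addrC subrK.
(* If Q lies in R, the extra vector can be 0. Otherwise q0 outside R has a nonzero coordinate on the
   first vector, and a multiple of q0 cancels that coordinate in any u of Q. *)
have [QR|/existsNP[q0 /not_implyP[Qq0 nRq0]]] := pselect (forall u, Q u -> R u).
  exists 0; first exact: subspace0.
  by move=> u Qu; exists 0; rewrite scaler0 subr0; split=> //; apply: QR.
exists q0 => // u Qu; have [a q0a] := eQ _ Qq0; have [b ub] := eQ _ Qu.
have a0 : a ord0 != 0.
  apply: contra_notN nRq0 => /eqP a0; exists (fun i => a (lift ord0 i)).
  by rewrite q0a big_ord_recl a0 scale0r add0r.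
exists (b ord0 / a ord0); split; first by apply: subspaceB => //;
  apply: subspaceZ.
exists (fun i => b (lift ord0 i) - b ord0 / a ord0 * a (lift ord0 i)).
rewrite ub q0a !big_ord_recl scalerDr scalerA divfK // opprD addrACA subrr add0r.
rewrite scaler_sumr -sumrB; apply: eq_bigr => i _.
by rewrite scalerBl scalerA.
Qed.

End Subspaces.

(** An annihilating polynomial of v splits into factors T - z. Applying them one at a time, the
    first one that kills a still nonzero vector exhibits an eigenvector. *)
Lemma exists_eigenvector (K : closedFieldType) (V : lmodType K)
    (T : {linear V -> V}) (P : set V) n v :
  dim_le P n -> subspace P -> (forall u, P u -> P (T u)) -> P v -> v <> 0 ->
  exists a w, [/\ P w, w <> 0 & T w = a *: w].
Proof.
move=> dP subP TP Pv; have [p p0] := dim_le_annihilator dP TP Pv.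
have [r ->] := closed_field_poly_normal p.
rewrite -lead_coef_eq0 in p0; move: (lead_coef p) p0 => c c0.
elim: r v Pv => [|z r IHr] v Pv.
  rewrite big_nil poly_appZ (poly_appC T 1) scale1r => /eqP.
  by rewrite scaler_eq0 (negPf c0) => /eqP.
rewrite big_cons mulrC scalerAl poly_appMXsubC.
have [Tv _ /eqP v0|/eqP Tv pv v0] := eqVneq (T v - z *: v) 0.
  by exists z, v; split=> //; apply/eqP; rewrite // -subr_eq0 Tv.
apply: IHr pv Tv; apply: subspaceB => //; [exact: TP|exact: subspaceZ].
Qed.

(** * Polynomial functions in the binomial basis *)

(** At most one n makes the sum vanish. The threshold is used to make quadratic sequences of
    eigenvalues injective. *)
Lemma addr_natS_neq0 (K : numDomainType) (c : K) :
  exists k0, forall n, (k0 <= n)%N -> c + n.+1%:R != 0.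
Proof.
have [[N N0]|nex] := pselect (exists N : nat, c + N.+1%:R = 0).
  exists N.+1 => n lt_Nn; apply: contraTneq lt_Nn => /eqP.
  by rewrite -N0 (inj_eq (addrI _)) eqr_nat eqSS => /eqP ->; rewrite ltnn.
by exists 0%N => n _; apply/eqP => n0; apply: nex; exists n.
Qed.

Section BinomialCoefficients.
Variable K : numFieldType.
Implicit Types x y : K.

Lemma binomial_coef0 x : binomial_coef x 0 = 1.
Proof. by rewrite /binomial_coef big_ord0 divr1. Qed.

Lemma binomial_coefS x i :
  i.+1%:R * binomial_coef x i.+1 = (x - i%:R) * binomial_coef x i.
Proof.
rewrite /binomial_coef big_ord_recr /= factS natrM.
have i0 : (i.+1%:R : K) != 0 by rewrite pnatr_eq0.
have f0 : (i`!%:R : K) != 0 by rewrite pnatr_eq0 -lt0n fact_gt0.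
by field; rewrite f0 addrC natr1.
Qed.

Lemma binomial_coefSE x i :
  binomial_coef x i.+1 = (i.+1%:R)^-1 * (x - i%:R) * binomial_coef x i.
Proof. by rewrite -mulrA -binomial_coefS mulKf // pnatr_eq0. Qed.

Lemma binomial_coef_nat n i : binomial_coef (n%:R : K) i = 'C(n, i)%:R.
Proof.
elim: i => [|i IHi]; first by rewrite binomial_coef0 bin0.
rewrite binomial_coefSE IHi; apply: (@mulfI _ i.+1%:R);
  first by rewrite pnatr_eq0.
rewrite !mulrA mulfV ?pnatr_eq0 // mul1r -natrM mul_bin_left natrM.
have [le_i|lt_n] := leqP i n; first by rewrite natrB.
by rewrite bin_small // !mulr0.
Qed.

(** Chu-Vandermonde identity for arbitrary arguments; it expresses that a twist by y followed by a
    twist by x is a twist by x + y. *)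
Lemma binomial_coef_vandermonde x y k :
  \sum_(i < k.+1) binomial_coef x i * binomial_coef y (k - i) =
  binomial_coef (x + y) k.
Proof.
elim: k => [|k IHk]; first by rewrite big_ord1 !binomial_coef0 mul1r.
apply: (@mulfI _ k.+1%:R); first by rewrite pnatr_eq0.
rewrite binomial_coefS -IHk mulr_sumr.
(* Splitting k + 1 = i + (k + 1 - i) lets each summand be absorbed by one of the two binomial
   coefficients through [binomial_coefS]. *)
have split_k (i : 'I_k.+2) : (k.+1%:R : K) = i%:R + (k.+1 - i)%:R.
  by rewrite -natrD subnKC // -ltnS.
under eq_bigr => i _ do rewrite [_ * _](congr1 ( *%R^~ _) (split_k i)) mulrDl.
rewrite big_split /= big_ord_recl /= mul0r add0r.
rewrite [X in _ + X]big_ord_recr /= subnn mul0r addr0 -big_split mulr_sumr.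
apply: eq_bigr => i _; rewrite /= /bump leq0n add1n subSS.
have le_ik : (i <= k)%N by rewrite -ltnS.
have := binomial_coefS y (k - i); have := binomial_coefS x i.
rewrite subSn // (natrB _ le_ik).
move: (binomial_coef x i.+1) (binomial_coef y _.+1) => b1 c1.
move: (binomial_coef x i) (binomial_coef y _) => b0 c0 eb ec.
by rewrite mulrA eb mulrCA ec; ring.
Qed.

End BinomialCoefficients.

Section PolynomialFunctions.
Variables (K : numFieldType) (V : lmodType K).
Implicit Types F G : K -> V.

(** Polynomial functions with values in V. The binomial basis replaces the powers of x because its
    values at natural numbers form a unitriangular matrix. *)
Definition poly_fun F : Prop := exists n (v : nat -> V),
  forall x, F x = \sum_(k < n) binomial_coef x k *: v k.

Lemma poly_fun_eq F G : F =1 G -> poly_fun F -> poly_fun G.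
Proof. by move=> FG [n [v Fv]]; exists n, v => x; rewrite -FG. Qed.

Lemma poly_fun_cst v : poly_fun (fun=> v).
Proof.
by exists 1%N, (fun=> v) => x; rewrite big_ord1 binomial_coef0 scale1r.
Qed.

Lemma poly_funD F G : poly_fun F -> poly_fun G -> poly_fun (fun x => F x + G x).
Proof.
have pad n m (v : nat -> V) x : (n <= m)%N ->
    \sum_(k < n) binomial_coef x k *: v k =
    \sum_(k < m) binomial_coef x k *: (if (k < n)%N then v k else 0).
  move=> le_nm; pose bv k := binomial_coef x k *: v k.
  rewrite (big_ord_widen_cond m xpredT bv le_nm).
  by rewrite big_mkcond; apply: eq_bigr => k _ /=; case: ifP; rewrite // scaler0.
move=> [n [v Fv]] [m [w Gw]].
exists (maxn n m), (fun k => (if (k < n)%N then v k else 0) +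
                             (if (k < m)%N then w k else 0)) => x.
rewrite Fv Gw (pad _ _ v x (leq_maxl n m)) (pad _ _ w x (leq_maxr n m))
  -big_split.
by apply: eq_bigr => k _; rewrite scalerDr.
Qed.

Lemma poly_fun_linear (T : {linear V -> V}) F :
  poly_fun F -> poly_fun (fun x => T (F x)).
Proof.
move=> [n [v Fv]]; exists n, (fun k => T (v k)) => x.
by rewrite Fv linear_sum; apply: eq_bigr => k _; rewrite linearZ.
Qed.

Lemma poly_funZ F a : poly_fun F -> poly_fun (fun x => a *: F x).
Proof. exact: (poly_fun_linear (a \*: @idfun V)). Qed.

Lemma poly_fun_sum n (F : 'I_n -> K -> V) :
  (forall i, poly_fun (F i)) -> poly_fun (fun x => \sum_i F i x).
Proof.
elim: n F => [|n IHn] F PF.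
  by apply: poly_fun_eq (poly_fun_cst 0) => x; rewrite big_ord0.
apply: (@poly_fun_eq (fun x => F ord0 x + \sum_(i < n) F (lift ord0 i) x)).
  by move=> x; rewrite big_ord_recl.
by apply: poly_funD => //; apply: IHn.
Qed.

(** Follows from x binom(x, k) = k binom(x, k) + (k+1) binom(x, k+1). *)
Lemma poly_fun_mulX F : poly_fun F -> poly_fun (fun x => x *: F x).
Proof.
move=> [n [v Fv]].
have PF (k : 'I_n) : poly_fun (fun x => x *: (binomial_coef x k *: v k)).
  exists k.+2, (fun j : nat => if j == k :> nat then k%:R *: v k else
                        if j == k.+1 then k.+1%:R *: v k else 0) => x.
  rewrite !big_ord_recr big1 /=; last first.
    by move=> i _; rewrite !ltn_eqF ?scaler0 // ltnW // ltnS.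
  rewrite add0r eqxx gtn_eqF // eqxx !scalerA -scalerDl; congr (_ *: _).
  rewrite [X in _ + X]mulrC binomial_coefS; ring.
apply: poly_fun_eq (poly_fun_sum PF) => x.
by rewrite Fv scaler_sumr.
Qed.

Lemma poly_fun_binomial F i :
  poly_fun F -> poly_fun (fun x => binomial_coef x i *: F x).
Proof.
move=> PF; elim: i => [|i IHi].
  by apply: poly_fun_eq PF => x; rewrite binomial_coef0 scale1r.
pose G x := binomial_coef x i *: F x.
apply: (@poly_fun_eq (fun x => (i.+1%:R)^-1 *: (x *: G x + (- i%:R) *: G x))).
  by move=> x; rewrite binomial_coefSE -scalerDl /G !scalerA.
by apply/poly_funZ/poly_funD; [apply: poly_fun_mulX|apply: poly_funZ].
Qed.

(** At x = k the terms of index above k vanish and the k-th coefficient is 1, so the v k vanish one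
    after the other. This carries identities from natural to complex parameters. *)
Lemma poly_fun_eq0 F : poly_fun F -> (forall n, F n%:R = 0) -> forall x, F x = 0.
Proof.
move=> [n [v Fv]] F0 x.
suff v0 k : (k < n)%N -> v k = 0.
  by rewrite Fv big1 // => k _; rewrite v0 // scaler0.
elim/ltn_ind: k => k IHk lt_kn.
have := F0 k; rewrite Fv (bigD1 (Ordinal lt_kn)) //= binomial_coef_nat binn
  scale1r.
rewrite big1 ?addr0 // => i /eqP/val_eqP /= ne_ik.
rewrite binomial_coef_nat; have [lt_ik|lt_ki|/eqP] := ltngtP i k.
- by rewrite IHk // scaler0.
- by rewrite bin_small // scale0r.
- by rewrite (negPf ne_ik).
Qed.

End PolynomialFunctions.

(** * Submodules of supermodules *)

HB.instance Definition _ (K : fieldType) (L : lmodType K) (LL : lieSuper L) x :=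
  GRing.isLinear.Build K L L *:%R (br LL x) ((br_bilinear LL).2 x).

HB.instance Definition _ (K : fieldType) (L : lmodType K) (LL : lieSuper L)
    (M : lmodType K) (MM : superModule LL M) x :=
  GRing.isLinear.Build K M M *:%R (act MM x) ((act_bilinear MM).2 x).

Lemma iter_cancel (T : Type) (f g : T -> T) n :
  cancel f g -> cancel (iter n f) (iter n g).
Proof. by move=> fK; elim: n => // n IHn m; rewrite iterSr iterS fK. Qed.

Section IteratedLinear.
Variables (K : fieldType) (V : lmodType K) (T : {linear V -> V}).

Lemma iter_linearP n a u v : iter n T (a *: u + v) = a *: iter n T u + iter n T v.
Proof. by elim: n => //= n ->; rewrite linearP. Qed.

Lemma iter_linearD n u v : iter n T (u + v) = iter n T u + iter n T v.
Proof. by rewrite -[u]scale1r iter_linearP !scale1r. Qed.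

Lemma iter_linear0 n : iter n T 0 = 0.
Proof. by elim: n => //= n ->; rewrite linear0. Qed.

Lemma iter_linearZ n a u : iter n T (a *: u) = a *: iter n T u.
Proof. by rewrite -[a *: u]addr0 iter_linearP iter_linear0 addr0. Qed.

Lemma iter_linear_sum n I (r : seq I) (F : I -> V) :
  iter n T (\sum_(i <- r) F i) = \sum_(i <- r) iter n T (F i).
Proof.
by elim: r => [|i r IHr];
  rewrite ?big_nil ?iter_linear0 // !big_cons iter_linearD IHr.
Qed.

Lemma iter_linear_eq0 n k v : (n <= k)%N -> iter n T v = 0 -> iter k T v = 0.
Proof. by move=> le_nk v0; rewrite -(subnK le_nk) iterD v0 iter_linear0. Qed.

End IteratedLinear.

Section SuperModules.
Variables (K : fieldType) (L : lmodType K) (LL : lieSuper L).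
Implicit Types (x y z : L).

Lemma lhom_subspace b : subspace (lhom LL b).
Proof. by case: (lhom_grading LL). Qed.

Lemma lhomP z : exists x y, [/\ lhom LL false x, lhom LL true y & z = x + y].
Proof. by case: (lhom_grading LL). Qed.

Lemma lhom_disjoint z : lhom LL false z -> lhom LL true z -> z = 0.
Proof. by case: (lhom_grading LL) => _ _; apply. Qed.

Lemma brDl x y z : br LL (x + y) z = br LL x z + br LL y z.
Proof. by rewrite -[x]scale1r (br_bilinear LL).1 !scale1r. Qed.

Lemma br0l z : br LL 0 z = 0.
Proof. by apply: (addrI (br LL 0 z)); rewrite -brDl !addr0. Qed.

Lemma brZl a x z : br LL (a *: x) z = a *: br LL x z.
Proof. by rewrite -[a *: x]addr0 (br_bilinear LL).1 br0l addr0. Qed.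

(** The axioms of [lieSuper] speak of homogeneous pairs; with x even no sign depends on y, so y may
    be arbitrary. *)
Lemma br_skew_even x y : lhom LL false x -> br LL x y = - br LL y x.
Proof.
move=> ex; have [y0 [y1 [ey oy ->]]] := lhomP y.
rewrite linearD /= brDl (br_skew ex ey) (br_skew ex oy) /=.
by rewrite !scaleN1r -opprD.
Qed.

Lemma br_jacobi_even x y z : lhom LL false x ->
  br LL x (br LL y z) = br LL (br LL x y) z + br LL y (br LL x z).
Proof.
move=> ex; have [y0 [y1 [ey oy ->]]] := lhomP y.
rewrite !(brDl, linearD) /= (br_jacobi _ ex ey) (br_jacobi _ ex oy) /=.
by rewrite !scale1r addrACA.
Qed.

Lemma lhom_br_even b x y :
  lhom LL false x -> lhom LL b y -> lhom LL b (br LL x y).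
Proof. exact: br_lhom. Qed.

Lemma br_even_self x : (2 : K) != 0 -> lhom LL false x -> br LL x x = 0.
Proof.
move=> two ex; apply/eqP; have /eqP := br_skew_even x ex.
by rewrite -addr_eq0 -mulr2n -scaler_nat scaler_eq0 (negPf two).
Qed.

Variables (M : lmodType K) (MM : superModule LL M).
Implicit Types (m : M) (P N : set M).

Lemma mhom_subspace b : subspace (mhom MM b).
Proof. by case: (mhom_grading MM). Qed.

Lemma mhomP m : exists m0 m1, [/\ mhom MM false m0, mhom MM true m1 & m = m0 +
  m1].
Proof. by case: (mhom_grading MM). Qed.

Lemma mhom_disjoint m : mhom MM false m -> mhom MM true m -> m = 0.
Proof. by case: (mhom_grading MM) => _ _; apply. Qed.

Lemma mhom_act_even b x m :
  lhom LL false x -> mhom MM b m -> mhom MM b (act MM x m).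
Proof. exact: act_mhom. Qed.

Lemma mhom_iter_even b x n m :
  lhom LL false x -> mhom MM b m -> mhom MM b (iter n (act MM x) m).
Proof. by move=> ex bm; elim: n => //= n; apply: mhom_act_even. Qed.

Lemma act_br_even x y m : lhom LL false x ->
  act MM (br LL x y) m = act MM x (act MM y m) - act MM y (act MM x m).
Proof.
move=> ex; have [y0 [y1 [ey oy ->]]] := lhomP y.
rewrite !linearD /= !actDl (act_br MM _ ex ey) (act_br MM _ ex oy) /= !scale1r.
by rewrite linearD /= opprD addrACA.
Qed.

Lemma act_comm_even x y m : lhom LL false x ->
  act MM x (act MM y m) = act MM (br LL x y) m + act MM y (act MM x m).
Proof. by move=> ex; rewrite act_br_even // subrK. Qed.

Definition submodule P : Prop :=
  graded_subspace (mhom MM) P /\ forall x m, P m -> P (act MM x m).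

Lemma submodule_subspace P : submodule P -> subspace P.
Proof. by case=> -[]. Qed.

Lemma submodule_iter P x n m :
  submodule P -> P m -> P (iter n (act MM x) m).
Proof. by move=> [_ sP] Pm; elim: n => //= n; apply: sP. Qed.

Lemma submodule_zero : submodule [set 0].
Proof.
split; last by move=> x m /= ->; rewrite act0r.
split=> [|v0 v1 e0 e1 /= /eqP]; first exact: subspace_zero.
rewrite addr_eq0 => /eqP v01.
have v00 : v0 = 0.
  apply: mhom_disjoint => //; rewrite v01; apply: subspaceN => //.
  exact: mhom_subspace.
by split=> //; apply/eqP; rewrite -oppr_eq0 -v01 v00.
Qed.

(** The vectors whose class modulo P is killed by a power of x. It is used for f over a nonzero
    submodule and for e over the zero submodule. *)
Definition saturation x P : set M := [set m | exists n, P (iter n (act MM x) m)].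

Lemma saturation_le x P n k m : submodule P -> (n <= k)%N ->
  P (iter n (act MM x) m) -> P (iter k (act MM x) m).
Proof.
by move=> sP le_nk Pn; rewrite -(subnK le_nk) iterD; apply: submodule_iter.
Qed.

(* Leibniz: x^(n + k) y m is a combination of the (ad x)^i y x^(n + k - i) m,
   in which either i >= n or n + k - i >= k. *)
Lemma iter_act_submodule x P : lhom LL false x -> submodule P ->
  forall n k y m, iter n (br LL x) y = 0 -> P (iter k (act MM x) m) ->
  P (iter (n + k) (act MM x) (act MM y m)).
Proof.
move=> ex sP n k; have [N le_N] := ubnP (n + k).
elim: N n k le_N => // N IHN [|n] [|k] lt_N y m y0 Pm.
- by rewrite /= in y0; rewrite y0 act0l /=;
    apply: subspace0 (submodule_subspace sP).
- rewrite /= in y0; rewrite y0 act0l; apply: submodule_iter => //.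
  exact: subspace0 (submodule_subspace sP).
- by apply: submodule_iter => //; apply: sP.2.
have subP := submodule_subspace sP.
rewrite addnS iterSr act_comm_even // iter_linearD; apply: subspaceD => //.
  by rewrite addSn -addnS; apply: IHN => //;
    rewrite -?iterSr // addnS -ltnS -addSn.
by apply: IHN => //; rewrite -?iterSr // -ltnS -addnS.
Qed.

(** Stability under y is [iter_act_submodule], thanks to the local nilpotency of ad x; the grading
    is kept because x is even. *)
Lemma submodule_saturation x P : (forall y, exists n, iter n (br LL x) y = 0) ->
  lhom LL false x -> submodule P -> submodule (saturation x P).
Proof.
move=> adx ex sP; have subP := submodule_subspace sP; split; last first.
  move=> y m [k Pm]; have [n yn] := adx y.
  by exists (n + k)%N; apply: iter_act_submodule.
split.
  split=> [|a u v [n Pu] [k Pv]]; first by exists 0%N; apply: subspace0.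
  exists (maxn n k); rewrite iter_linearP; apply: subP.2.
    exact: saturation_le (leq_maxl _ _) Pu.
  exact: saturation_le (leq_maxr _ _) Pv.
move=> v0 v1 e0 e1 [n]; rewrite iter_linearD.
by case/sP.1.2 => [||P0 P1]; [exact: mhom_iter_even..|split; exists n].
Qed.

End SuperModules.

(** * Twisting by a complex power of f *)

Section Twist.
Variables (K : numFieldType) (L : lmodType K) (LL : lieSuper L) (f : L).
Hypotheses (even_f : lhom LL false f)
  (nil_f : forall y, exists n, iter n (br LL f) y = 0).
Variables (M : lmodType K) (MM : superModule LL M) (g : {linear M -> M}).
Hypotheses (fK : cancel (act MM f) g) (gK : cancel g (act MM f)).
Local Notation ad := (br LL f).
Implicit Types (x : K) (y z : L) (m : M).

Definition nil_index y : nat := projT1 (cid (nil_f y)).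

Lemma nil_indexP y : iter (nil_index y) ad y = 0.
Proof. by rewrite /nil_index; case: cid. Qed.

(** The action of sum_i binom(x, i) (ad f)^i(y) f^-i, with g in the role of f^-1. The sum stops at a
    chosen exponent killing y; by [twist_actE] any such exponent gives the same value. *)
Definition twist_act x y m : M :=
  \sum_(i < nil_index y) binomial_coef x i *: act MM (iter i ad y) (iter i g m).

Lemma twist_actE x y m n : iter n ad y = 0 -> twist_act x y m =
  \sum_(i < n) binomial_coef x i *: act MM (iter i ad y) (iter i g m).
Proof.
have trunc k l : (k <= l)%N -> iter k ad y = 0 ->
    \sum_(i < l) binomial_coef x i *: act MM (iter i ad y) (iter i g m) =
    \sum_(i < k) binomial_coef x i *: act MM (iter i ad y) (iter i g m).
  move=> le_kl yk; pose F i := binomial_coef x i *: act MM (iter i ad y) (iter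
    i g m).
  rewrite -!(big_mkord xpredT F) (big_cat_nat (leq0n k) le_kl) /=.
  rewrite [X in _ + X]big_nat [X in _ + X]big1 ?addr0 // => i /andP[le_ki _].
  by rewrite /F (iter_linear_eq0 le_ki yk) act0l scaler0.
move=> yn; rewrite -(trunc _ _ (leq_maxl n (nil_index y)) yn).
by rewrite (trunc _ _ (leq_maxr n _)) // nil_indexP.
Qed.

Lemma twist_act_bilinear x : bilinear_op (twist_act x).
Proof.
split=> [a y z m|y a u v].
  pose n := maxn (nil_index y) (nil_index z).
  have yn : iter n ad y = 0 by apply: iter_linear_eq0 (leq_maxl _ _)
    (nil_indexP y).
  have zn : iter n ad z = 0 by apply: iter_linear_eq0 (leq_maxr _ _)
    (nil_indexP z).
  have wn : iter n ad (a *: y + z) = 0.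
    by rewrite iter_linearP yn zn scaler0 addr0.
  rewrite !(twist_actE _ _ (n := n)) // scaler_sumr -big_split.
  apply: eq_bigr => i _ /=; rewrite iter_linearP actDl actZl scalerDr.
  by rewrite !scalerA mulrC.
rewrite /twist_act scaler_sumr -big_split; apply: eq_bigr => i _ /=.
by rewrite iter_linearP linearP scalerDr !scalerA mulrC.
Qed.

(** For a natural parameter the twist is conjugation by f^n: induction with Pascal's rule and f z =
    [f, z] + z f for z = (ad f)^i(y). *)
Lemma twist_act_nat n y m :
  twist_act n%:R y m = iter n (act MM f) (act MM y (iter n g m)).
Proof.
have twE k u : twist_act k%:R y u =
    \sum_(i < (nil_index y).+1) 'C(k, i)%:R *: act MM (iter i ad y) (iter i g u).
  rewrite (twist_actE _ _ (n := (nil_index y).+1)) /=; last first.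
    by rewrite nil_indexP linear0.
  by apply: eq_bigr => i _; rewrite binomial_coef_nat.
elim: n m => [|n IHn] m.
  rewrite twE big_ord_recl /= bin0 scale1r big1 ?addr0 // => i _.
  by rewrite bin0n scale0r.
rewrite iterS [iter n.+1 g m]iterSr -IHn twE.
rewrite big_ord_recl /= bin0 scale1r.
under eq_bigr do rewrite /bump leq0n add1n binS natrD scalerDl.
rewrite big_split addrA /= -[X in X + _](_ : twist_act n%:R y m = _); last first.
  rewrite twE big_ord_recl bin0 scale1r; congr (_ + _).
rewrite /twist_act -big_split linear_sum; apply: eq_bigr => i _ /=.
rewrite binomial_coef_nat linearZ /= -scalerDr act_comm_even // addrC -iterSr /=.
by rewrite gK.
Qed.

(** The argument F may depend on x as well, so that composites of two twisted operators are
    covered. *)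
Lemma poly_fun_twist F y :
  poly_fun F -> poly_fun (fun x => twist_act x y (F x)).
Proof.
move=> PF; apply: poly_fun_sum => i; apply: poly_fun_binomial.
apply: poly_fun_linear; elim: (nat_of_ord i) => //= j; exact: poly_fun_linear.
Qed.

(** Both sides are polynomial in x, and for x = n conjugation by f^n respects supercommutators. *)
Lemma twist_act_br x a b y z m : lhom LL a y -> lhom LL b z ->
  twist_act x (br LL y z) m = twist_act x y (twist_act x z m) -
    (-1) ^+ (a && b) *: twist_act x z (twist_act x y m).
Proof.
move=> hy hz; apply/eqP; rewrite -subr_eq0; apply/eqP; move: x.
have Pm := poly_fun_cst m.
apply: poly_fun_eq0 => [|n].
  apply: (@poly_fun_eq _ _ (fun x => twist_act x (br LL y z) m +
    (-1) *: (twist_act x y (twist_act x z m) +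
      - (-1) ^+ (a && b) *: twist_act x z (twist_act x y m)))).
    by move=> x; rewrite scaleN1r scaleNr.
  apply: poly_funD; first exact: poly_fun_twist.
  by apply/poly_funZ/poly_funD; [|apply: poly_funZ]; do 2!apply: poly_fun_twist.
apply/eqP; rewrite subr_eq0; apply/eqP.
rewrite !twist_act_nat !(iter_cancel _ fK) (act_br MM _ hy hz).
by rewrite -scaleNr iter_linearD iter_linearZ scaleNr.
Qed.

(** A component of g m of the wrong parity would be sent by the even operator f to a vector of both
    parities, hence to 0, and f is injective. *)
Lemma mhom_inverse b m : mhom MM b m -> mhom MM b (g m).
Proof.
have half c u v : mhom MM c (act MM f u + act MM f v) -> mhom MM c u ->
    mhom MM (~~ c) v -> mhom MM c (u + v).
  move=> cfuv cu cv; suff -> : v = 0 by rewrite addr0.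
  have cfv : mhom MM c (act MM f v).
    rewrite -[act MM f v](addKr (act MM f u)) addrC.
    apply: subspaceB => //; first exact: mhom_subspace.
    exact: mhom_act_even.
  have ncfv : mhom MM (~~ c) (act MM f v) by apply: mhom_act_even.
  apply: (can_inj fK); rewrite act0r.
  by case: c cfv ncfv {cfuv cu cv} => *; apply: (mhom_disjoint (MM := MM)).
move=> bm; have [m0 [m1 [e0 o1 gm]]] := mhomP MM (g m).
have fm : m = act MM f m0 + act MM f m1 by rewrite -[LHS]gK gm linearD.
rewrite gm; case: b bm; rewrite {}fm => bm; last exact: half.
by rewrite addrC; apply: half => //; rewrite addrC.
Qed.

Lemma mhom_iter_inverse b n m : mhom MM b m -> mhom MM b (iter n g m).
Proof. by move=> bm; elim: n => //= n; apply: mhom_inverse. Qed.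

Lemma lhom_iter_ad b n y : lhom LL b y -> lhom LL b (iter n ad y).
Proof. by move=> hy; elim: n => //= n; apply: lhom_br_even. Qed.

Lemma twist_act_mhom x a b y m : lhom LL a y -> mhom MM b m ->
  mhom MM (a (+) b) (twist_act x y m).
Proof.
move=> hy hm; have subM := mhom_subspace MM; apply: subspace_sum => // i _.
apply: subspaceZ => //; apply: act_mhom.
  exact: lhom_iter_ad.
exact: mhom_iter_inverse.
Qed.

Definition twist x : superModule LL M :=
  SuperModule (mhom_grading MM) (twist_act_bilinear x) (@twist_act_mhom x)
    (@twist_act_br x).

(** Since [f, f] = 0, only the terms i = 0 and i = 1 survive, and the second is x c f f^-1. This
    covers Cartan elements, the central element and f itself. *)
Lemma twist_act_eigen x c y m : br LL f y = c *: f ->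
  act (twist x) y m = act MM y m + (x * c) *: m.
Proof.
have two : (2 : K) != 0 by rewrite pnatr_eq0.
move=> fy; rewrite /= (@twist_actE x y m 2) /= ?fy; last first.
  by rewrite linearZ /= br_even_self // scaler0.
rewrite !big_ord_recl big_ord0 /= fy addr0 binomial_coef0 scale1r.
by rewrite binomial_coefSE binomial_coef0 subr0 invr1 mulr1 mul1r actZl gK
  scalerA.
Qed.

Lemma twist_act_self x m : act (twist x) f m = act MM f m.
Proof.
have two : (2 : K) != 0 by rewrite pnatr_eq0.
rewrite (@twist_act_eigen _ 0) ?mulr0 ?scale0r ?addr0 //.
exact: br_even_self.
Qed.

(** Cauchy product: the terms are regrouped by k = i + j, and those with k >= n vanish. *)
Lemma triangular_sum n (a b : nat -> K) (t : nat -> M) :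
  (forall k, (n <= k)%N -> t k = 0) ->
  \sum_(i < n) \sum_(j < n) (a i * b j) *: t (i + j)%N =
  \sum_(k < n) (\sum_(i < k.+1) a i * b (k - i)%N) *: t k.
Proof.
move=> t0.
transitivity (\sum_(i < n) \sum_(k < n | (i <= k)%N) (a i * b (k - i)%N) *: t k).
  apply: eq_bigr => i _; pose F j := (a i * b j) *: t (i + j)%N.
  rewrite -(big_mkord xpredT F) (big_cat_nat (leq0n (n - i)) (leq_subr i n)) /=.
  rewrite [X in _ + X]big_nat [X in _ + X]big1 ?addr0; last first.
    by move=> j /andP[]; rewrite leq_subLR => /t0 tj _; rewrite /F tj scaler0.
  pose G k := (a i * b (k - i)%N) *: t k; rewrite -(big_mkord (leq i) G).
  transitivity (\sum_(i <= k < n) G k).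
    rewrite -[nat_of_ord i in RHS]add0n big_addn.
    by apply: eq_bigr => j _; rewrite /F /G addnK addnC.
  by rewrite (big_nat_widenl i 0).
rewrite (exchange_big_dep predT) //=; apply: eq_bigr => k _.
rewrite scaler_suml (big_ord_widen_cond n xpredT (fun i =>
  (a i * b (k - i)%N) *: t k)) //.
Qed.

(** Twisting by - x undoes twisting by x: by Vandermonde the coefficients become binom(0, k). The
    inverse g is unchanged, as f acts in the same way on both modules. *)
Lemma twist_act_opp x y m n : iter n ad y = 0 ->
  \sum_(i < n) binomial_coef (- x) i *:
    act (twist x) (iter i ad y) (iter i g m) = act MM y m.
Proof.
move=> yn; pose t k := act MM (iter k ad y) (iter k g m).
transitivity (\sum_(i < n) \sum_(j < n)
  (binomial_coef (- x) i * binomial_coef x j) *: t (i + j)%N).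
  apply: eq_bigr => i _; rewrite /= (@twist_actE _ _ _ n); last first.
    by rewrite -iterD; apply: iter_linear_eq0 (leq_addr _ _) yn.
  rewrite scaler_sumr; apply: eq_bigr => j _.
  by rewrite /t -!iterD addnC scalerA.
rewrite triangular_sum; last first.
  by move=> k le_nk; rewrite /t (iter_linear_eq0 le_nk yn) act0l.
under eq_bigr do rewrite binomial_coef_vandermonde addNr.
case: n yn => [/= ->|n _]; first by rewrite big_ord0 act0l.
rewrite big_ord_recl binomial_coef0 scale1r big1 ?addr0 // => i _.
by rewrite (binomial_coef_nat K 0) scale0r.
Qed.

End Twist.

(** * Localization of a submodule *)

Section SubModule.
Variables (K : fieldType) (L : lmodType K) (LL : lieSuper L).
Variables (M : lmodType K) (MM : superModule LL M) (P : set M).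
Implicit Type sP : submodule MM P.

(** The index [sP] ties the predicate to its closure proof, from which the module structure on
    [subcarrier] is inferred. *)
Definition submodule_pred sP : M -> bool := fun m => `[< P m >].

Lemma submodule_pred_closed sP : submod_closed (submodule_pred sP).
Proof.
have subP := submodule_subspace sP.
split=> [|a u v /asboolP Pu /asboolP Pv]; apply/asboolP.
  exact: subspace0.
exact: subP.2.
Qed.

HB.instance Definition _ sP :=
  GRing.isSubmodClosed.Build K M (submodule_pred sP) (submodule_pred_closed sP).

Record subcarrier sP := Subcarrier {
  subcarrier_val : M;
  subcarrier_valP : subcarrier_val \in submodule_pred sP
}.

HB.instance Definition _ sP := [isSub for @subcarrier_val sP].
HB.instance Definition _ sP := [Choice of subcarrier sP by <:].
HB.instance Definition _ sP := [SubChoice_isSubLmodule of subcarrier sP by <:].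

HB.instance Definition _ sP :=
  GRing.isLinear.Build K (subcarrier sP) M *:%R (@subcarrier_val sP)
    (linearP (\val : subcarrier sP -> M)).

Lemma subcarrierP sP (u : subcarrier sP) : P (\val u).
Proof. exact/asboolP/(valP u). Qed.

Definition in_subcarrier sP m (Pm : P m) : subcarrier sP :=
  Subcarrier (introT (asboolP _) Pm : m \in submodule_pred sP).

Definition sub_act sP y (u : subcarrier sP) : subcarrier sP :=
  in_subcarrier sP (sP.2 y _ (subcarrierP u)).

Definition sub_mhom sP b : set (subcarrier sP) := [set u | mhom MM b (\val u)].
Arguments sub_mhom : clear implicits.

Lemma sub_mhom_grading sP : grading (sub_mhom sP).
Proof.
split=> [b|u|u e0 e1].
- split=> [|a u v bu bv]; rewrite /sub_mhom /= ?linear0 ?linearP.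
    exact: subspace0 (mhom_subspace MM b).
  by apply: (mhom_subspace MM b).2.
- have [m0 [m1 [e0 o1 um]]] := mhomP MM (\val u).
  have [P0 P1] : P m0 /\ P m1.
    by apply: sP.1.2 => //; rewrite -um; apply: subcarrierP.
  exists (in_subcarrier sP P0), (in_subcarrier sP P1); split=> //.
  by apply: val_inj; rewrite linearD.
- apply: val_inj; rewrite linear0; exact: mhom_disjoint e0 e1.
Qed.

Lemma sub_act_bilinear sP : bilinear_op (@sub_act sP).
Proof.
split=> [a x y u|x a u v]; apply: val_inj; rewrite linearP /=.
  exact: (act_bilinear MM).1.
by rewrite !linearP.
Qed.

Lemma sub_act_mhom sP a b x u : lhom LL a x -> sub_mhom sP b u ->
  sub_mhom sP (a (+) b) (sub_act x u).
Proof. exact: act_mhom. Qed.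

Lemma sub_act_br sP a b x y (u : subcarrier sP) : lhom LL a x -> lhom LL b y ->
  sub_act (br LL x y) u =
  sub_act x (sub_act y u) - (-1) ^+ (a && b) *: sub_act y (sub_act x u).
Proof.
move=> hx hy; apply: val_inj; rewrite linearB linearZ /=.
by rewrite scalerN; exact: (act_br MM _ hx hy).
Qed.

Definition sub_superModule sP : superModule LL (subcarrier sP) :=
  SuperModule (sub_mhom_grading sP) (sub_act_bilinear sP) (@sub_act_mhom sP)
    (@sub_act_br sP).

Lemma val_iter_sub_act sP x n (u : subcarrier sP) :
  \val (iter n (act (sub_superModule sP) x) u) = iter n (act MM x) (\val u).
Proof. by elim: n => //= n <-. Qed.

End SubModule.

(** * Localizing a submodule S whose f-saturation is M gives back M *)

Section LocalizedSubmodule.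
Variables (K : fieldType) (L : lmodType K) (LL : lieSuper L) (f : L).
Hypotheses (even_f : lhom LL false f)
  (nil_f : forall y, exists n, iter n (br LL f) y = 0).
Variables (M : lmodType K) (MM : superModule LL M) (g : {linear M -> M}).
Hypotheses (fK : cancel (act MM f) g) (gK : cancel g (act MM f)).

Local Notation U := (enveloping LL).
Local Notation Uf := (env_loc LL f).
Local Notation j := (env_loc_in LL f).
Implicit Types (b c : U) (u v : Uf) (m : M).

Lemma env_genD x y : env_gen LL (x + y) = env_gen LL x + env_gen LL y.
Proof. by rewrite /env_gen -pr_class_add; apply/pr_classP/rc_rel/er_genD. Qed.

Lemma env_gen0 : env_gen LL 0 = 0.
Proof. by apply: (addrI (env_gen LL 0)); rewrite -env_genD !addr0. Qed.

Lemma env_cst1 : env_cst LL 1 = 1.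
Proof. exact/pr_classP/rc_rel/er_cst1. Qed.

Lemma env_gen_br x y : lhom LL false x -> env_gen LL (br LL x y) =
  env_gen LL x * env_gen LL y - env_gen LL y * env_gen LL x.
Proof.
move=> ex; have hom p z : lhom LL p z -> env_gen LL (br LL x z) =
    env_gen LL x * env_gen LL z - env_gen LL z * env_gen LL x.
  move=> hz; have /pr_classP := rc_rel (er_br ex hz).
  rewrite pr_class_add pr_class_opp !pr_class_mul /= expr0.
  by rewrite -/(env_cst LL 1) env_cst1 mul1r.
have [y0 [y1 [e0 o1 ->]]] := lhomP LL y.
rewrite linearD /= !env_genD (hom _ _ e0) (hom _ _ o1).
by rewrite mulrDr mulrDl opprD addrACA.
Qed.

Lemma env_gen_act x m : env_act (env_gen LL x) (m : env_module MM) = act MM x m.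
Proof. exact: env_actE. Qed.

Lemma env_cst_act k m : env_act (env_cst LL k) (m : env_module MM) = k *: m.
Proof. exact: env_actE. Qed.

(** As f is bijective on M, the space M is itself a module over the localized ring, the generator
    [None] acting as g. *)
Fixpoint loc_term_act (t : ring_term (option U)) (m : env_module MM) :
    env_module MM :=
  match t with
  | Gen (Some b) => env_act b m
  | Gen None => g m
  | Zero => 0
  | One => m
  | Opp s => - loc_term_act s m
  | Add s t => loc_term_act s m + loc_term_act t m
  | Mul s t => loc_term_act s (loc_term_act t m)
  end.

Lemma loc_term_actD t : {morph loc_term_act t : m n / m + n}.
Proof.
elim: t => [[b|]|||s IHs|s IHs t IHt|s IHs t IHt] m n //=.
- exact: env_actDr.
- exact: (linearD g).
- by rewrite addr0.
- by rewrite IHs opprD.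
- by rewrite IHs IHt addrACA.
- by rewrite IHt IHs.
Qed.

Lemma loc_term_act_cong s t :
  ring_cong (loc_rel (env_gen LL f)) s t -> loc_term_act s =1 loc_term_act t.
Proof.
elim=> {s t} //=.
- move=> s t; case=> [|b c|b c||] m /=.
  + exact: env_act1.
  + exact: env_actDl.
  + by rewrite env_actA.
  + by rewrite env_gen_act fK.
  + by rewrite env_gen_act gK.
- by move=> s t _ IH m; rewrite IH.
- by move=> s t u _ IHst _ IHtu m; rewrite IHst IHtu.
- by move=> s t _ IH m; rewrite IH.
- by move=> s s' t t' _ IHs _ IHt m; rewrite IHs IHt.
- by move=> s s' t t' _ IHs _ IHt m; rewrite IHt IHs.
- by move=> s t u m; rewrite addrA.
- by move=> s t m; rewrite addrC.
- by move=> t m; rewrite add0r.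
- by move=> t m; rewrite addNr.
- by move=> s t u m; rewrite loc_term_actD.
Qed.

Definition loc_act u m : M := loc_term_act (repr u) m.

Lemma loc_actE t m : loc_act (pr_class _ t) m = loc_term_act t m.
Proof. exact/loc_term_act_cong/repr_pr_class. Qed.

Lemma loc_act_in b m : loc_act (j b) m = env_act b (m : env_module MM).
Proof. exact: loc_actE. Qed.

Lemma loc_act_inv m : loc_act (env_loc_inv LL f) m = g m.
Proof. exact: loc_actE. Qed.

Lemma loc_actM u v m : loc_act (u * v) m = loc_act u (loc_act v m).
Proof.
elim/pr_ind: u => s; elim/pr_ind: v => t.
by rewrite -pr_class_mul !loc_actE.
Qed.

Lemma loc_actDl u v m : loc_act (u + v) m = loc_act u m + loc_act v m.
Proof.
elim/pr_ind: u => s; elim/pr_ind: v => t.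
by rewrite -pr_class_add !loc_actE.
Qed.

Lemma loc_act0l m : loc_act 0 m = 0.
Proof. exact: (loc_actE Zero). Qed.

Lemma loc_act1 m : loc_act 1 m = m.
Proof. exact: (loc_actE One). Qed.

Lemma loc_actDr u m n : loc_act u (m + n) = loc_act u m + loc_act u n.
Proof. exact: loc_term_actD. Qed.

Lemma loc_act0r u : loc_act u 0 = 0.
Proof. by apply: (addrI (loc_act u 0)); rewrite -loc_actDr !addr0. Qed.

Lemma loc_act_invX n m : loc_act (env_loc_inv LL f ^+ n) m = iter n g m.
Proof.
elim: n => [|n IHn]; first by rewrite expr0 loc_act1.
by rewrite exprS loc_actM IHn loc_act_inv.
Qed.

Lemma loc_act_sum n (u : 'I_n -> Uf) m :
  loc_act (\sum_i u i) m = \sum_i loc_act (u i) m.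
Proof.
by elim/big_rec2: _ => [|i v w _ <-]; rewrite ?loc_act0l // loc_actDl.
Qed.

Lemma mul_inv_gen : env_loc_inv LL f * j (env_gen LL f) = 1.
Proof. by rewrite -pr_class_mul; apply/pr_classP/rc_rel/lr_invl. Qed.

Lemma mul_gen_inv : j (env_gen LL f) * env_loc_inv LL f = 1.
Proof. by rewrite -pr_class_mul; apply/pr_classP/rc_rel/lr_invr. Qed.

Lemma mul_invX_genX n : env_loc_inv LL f ^+ n * j (env_gen LL f) ^+ n = 1.
Proof.
elim: n => [|n IHn]; first by rewrite mulr1.
by rewrite exprSr exprS mulrA -(mulrA _ (env_loc_inv LL f)) mul_inv_gen mulr1.
Qed.

(** Ore condition for one generator: moving powers of f across y costs brackets (ad f)^i(y), which
    vanish from i = n on. *)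
Lemma ore_gen (n m : nat) y : iter n (br LL f) y = 0 -> exists b,
  env_gen LL f ^+ (n + m) * env_gen LL y = b * env_gen LL f ^+ m.
Proof.
have [N le_N] := ubnP (n + m).
elim: N n m le_N y => // N IHN [|n] [|m] lt_N y yn.
- by exists (env_gen LL y); rewrite mul1r mulr1.
- by rewrite /= in yn; exists 0; rewrite yn env_gen0 mulr0 mul0r.
- by exists (env_gen LL f ^+ (n.+1 + 0) * env_gen LL y); rewrite mulr1.
(* From f y = [f, y] + y f: the first term lowers the nilpotency exponent n, the second lowers m. *)
have [||b1 e1] := IHN n m.+1 _ (br LL f y); rewrite -?iterSr //.
have [||b2 e2] := IHN n.+1 m _ y => //; first by rewrite -ltnS -addnS.
exists (b1 + b2); rewrite mulrDl -e1 [X in _ + b2 * X]exprSr mulrA -e2.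
by rewrite !addnS !addSn [in LHS]exprSr -!mulrA -mulrDr env_gen_br // subrK.
Qed.

(** Induction on a term for b: scalars commute with f, a sum takes the sum of the exponents, and a
    product applies the condition to its right factor and then to its left one. *)
Lemma ore_condition b (m : nat) : exists k c,
  env_gen LL f ^+ k * b = c * env_gen LL f ^+ m.
Proof.
elim/pr_ind: b => t; elim: t m => [[y|a]|||s IHs|s IHs t IHt|s IHs t IHt] m.
- have [n yn] := nil_f y; have [c e] := ore_gen m yn.
  by exists (n + m)%N, c.
- exists m, (env_cst LL a); rewrite -/(env_cst LL a).
  have comm x : env_gen LL x * env_cst LL a = env_cst LL a * env_gen LL x.
    apply/esym; rewrite /env_gen /env_cst -!pr_class_mul.
    exact/pr_classP/rc_rel/er_cstC.
  elim: m => [|m IHm]; first by rewrite mulr1 mul1r.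
  by rewrite exprS -mulrA IHm mulrA comm -mulrA.
- by exists 0%N, 0; rewrite mul0r mulr0.
- by exists m, 1; rewrite mul1r mulr1.
- by have [k [c e]] := IHs m; exists k, (- c); rewrite pr_class_opp mulrN mulNr e.
- have [k [c ec]] := IHs m; have [l [d ed]] := IHt m.
  exists (k + l)%N, (env_gen LL f ^+ l * c + env_gen LL f ^+ k * d).
  rewrite pr_class_add mulrDr mulrDl -!mulrA -ec -ed !mulrA -!exprD.
  by rewrite addnC.
- have [l [d ed]] := IHt m; have [k [c ec]] := IHs l.
  by exists k, (c * d); rewrite pr_class_mul mulrA ec -mulrA ed mulrA.
Qed.

Local Notation F := (j (env_gen LL f)).
Local Notation G := (env_loc_inv LL f).

(** Every element of the localized ring is a left fraction f^-n b; for a product the Ore condition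
    moves the inner denominator to the left. *)
Lemma loc_fraction u : exists n b, F ^+ n * u = j b.
Proof.
elim/pr_ind: u => t; elim: t => [[b|]|||s IHs|s IHs t IHt|s IHs t IHt].
- by exists 0%N, b; rewrite mul1r.
- by exists 1%N, 1; rewrite rmorph1 -mul_gen_inv.
- by exists 0%N, 0; rewrite mul1r rmorph0.
- by exists 0%N, 1; rewrite mul1r rmorph1.
- by have [n [b e]] := IHs; exists n, (- b); rewrite pr_class_opp mulrN rmorphN e.
- have [n [b eb]] := IHs; have [m [c ec]] := IHt.
  exists (n + m)%N, (env_gen LL f ^+ m * b + env_gen LL f ^+ n * c).
  rewrite pr_class_add rmorphD !rmorphM !rmorphXn /= -eb -ec mulrDr !mulrA
    -!exprD.
  by rewrite addnC.
- have [n [b eb]] := IHs; have [m [c ec]] := IHt.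
  have [k [d ed]] := ore_condition b m.
  exists (k + n)%N, (d * c).
  rewrite pr_class_mul exprD mulrA -(mulrA _ _ (pr_class _ s)) eb -rmorphXn
    -rmorphM.
  by rewrite ed !rmorphM rmorphXn /= -mulrA ec.
Qed.

Variables (S : set M) (sS : submodule MM S).
Hypothesis S_sat : forall m, exists n, S (iter n (act MM f) m).

Local Notation OO := (sub_superModule sS).
Local Notation EO := (env_module OO).
Local Notation T := (localized_module f OO).

Lemma val_env_act b (w : EO) :
  subcarrier_val (env_act b w : subcarrier sS) =
  env_act b (subcarrier_val (w : subcarrier sS) : env_module MM).
Proof.
elim/pr_ind: b => t; rewrite !env_actE.
elim: t w => [[x|k]|||s IHs|s IHs t IHt|s IHs t IHt] w //=.
- by rewrite IHs.
- by rewrite IHs IHt.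
- by rewrite IHs IHt.
Qed.

(** The multiplication map from the tensor product to M, sending u (x) w to u w; it will be the
    inverse of [localize]. *)
Fixpoint tensor_term_eval (t : tensor_term Uf EO) : M :=
  match t with
  | Tens u w => loc_act u (subcarrier_val (w : subcarrier sS))
  | TZero => 0
  | TAdd t t' => tensor_term_eval t + tensor_term_eval t'
  end.

Lemma tensor_term_eval_cong t t' :
  tensor_cong j t t' -> tensor_term_eval t = tensor_term_eval t'.
Proof.
elim=> {t t'} //=.
- by move=> t t' u _ -> _ ->.
- by move=> t t' u u' _ -> _ ->.
- by move=> t u v; rewrite addrA.
- by move=> t u; rewrite addrC.
- by move=> t; rewrite add0r.
- by move=> u v w; rewrite loc_actDl.
- by move=> u w w'; rewrite -loc_actDr.
- by move=> w; rewrite loc_act0l.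
- by move=> u b w; rewrite loc_actM loc_act_in val_env_act.
Qed.

Definition tensor_eval (t : T) : M := tensor_term_eval (repr t).

Lemma tensor_evalE (t : tensor_term Uf EO) :
  tensor_eval (ts_class j t) = tensor_term_eval t.
Proof. exact/tensor_term_eval_cong/repr_ts_class. Qed.

Lemma tensor_eval_tens u (w : EO) :
  tensor_eval (tens j u w) = loc_act u (subcarrier_val (w : subcarrier sS)).
Proof. exact: tensor_evalE. Qed.

Lemma tensor_evalD (t t' : T) : tensor_eval (t + t') = tensor_eval t +
  tensor_eval t'.
Proof.
elim/ts_ind: t => t; elim/ts_ind: t' => t'.
by rewrite [_ + _]ts_addE !tensor_evalE.
Qed.

Lemma tensor_evalZ u (t : T) : tensor_eval (u *: t) = loc_act u (tensor_eval t).
Proof.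
elim/ts_ind: t => t; rewrite [_ *: _]ts_scaleE !tensor_evalE.
elim: t => [v w||t IHt t' IHt'] /=; first by rewrite loc_actM.
  by rewrite loc_act0r.
by rewrite IHt IHt' loc_actDr.
Qed.

Lemma tens_balanced u b (w : EO) : tens j (u * j b) w = tens j u (b *: w).
Proof. exact/ts_classP/tc_tens_balanced. Qed.

Lemma tensDr u (w w' : EO) : tens j u (w + w') = tens j u w + tens j u w'.
Proof. by rewrite [RHS]ts_addE; apply/ts_classP/tc_tensDr. Qed.

Lemma tens0r u : tens j u (0 : EO) = 0.
Proof. by apply: (addrI (tens j u 0)); rewrite -tensDr !addr0. Qed.

Lemma scale_tens u v (w : EO) : u *: tens j v w = tens j (u * v) w.
Proof. exact: ts_scaleE. Qed.

(** Clearing denominators: fractions are removed from each pure tensor, and a sum uses the product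
    of the two powers of f. *)
Lemma tensor_fraction (t : T) : exists n (w : EO), F ^+ n *: t = tens j 1 w.
Proof.
elim/ts_ind: t; elim=> [u w||t [n [w ew]] t' [n' [w' ew']]].
- have [n [b e]] := loc_fraction u; exists n, (b *: w).
  by rewrite [LHS]scale_tens e -tens_balanced mul1r.
- by exists 0%N, 0; rewrite tens0r [LHS]scaler0.
- exists (n + n')%N,
    ((env_gen LL f ^+ n' : U) *: w + (env_gen LL f ^+ n : U) *: w').
  have -> : ts_class j (TAdd t t') = ts_class j t + ts_class j t'.
    by rewrite [RHS]ts_addE.
  rewrite tensDr -!tens_balanced !rmorphXn /= !mul1r scalerDr.
  rewrite {1}addnC !exprD -!scalerA ew ew' !scale_tens !mulr1; congr (_ + _).
Qed.

(** If t evaluates to 0 and f^n t = 1 (x) w, then w evaluates to 0, so w = 0; since f^n is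
    invertible, t = 0. *)
Lemma tensor_eval_inj : injective tensor_eval.
Proof.
move=> t t' e; apply/eqP; rewrite -subr_eq0; apply/eqP.
have {e} : tensor_eval (t - t') = 0.
  by rewrite -scaleN1r tensor_evalD tensor_evalZ e -[X in X + _]loc_act1
     -loc_actDl subrr loc_act0l.
move: (t - t') => {t t'} t t0; have [n [w ew]] := tensor_fraction t.
have w0 : w = 0.
  apply: (val_inj : injective (\val : subcarrier sS -> M)); rewrite linear0.
  by rewrite -[LHS]loc_act1 -tensor_eval_tens -ew tensor_evalZ t0 loc_act0r.
by rewrite -[t]scale1r -(mul_invX_genX n) -scalerA ew w0 tens0r scaler0.
Qed.

(** The preimage f^-n (x) f^n m of m, for some n with f^n m in S; by injectivity of [tensor_eval]
    the choice of n does not affect it. *)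
Definition localize m : T :=
  let n := projT1 (cid (S_sat m)) in
  G ^+ n *: tens j 1 (in_subcarrier sS (projT2 (cid (S_sat m))) : EO).

Lemma localizeK : cancel localize tensor_eval.
Proof.
move=> m; rewrite /localize; case: cid => n Sm /=.
rewrite tensor_evalZ tensor_eval_tens loc_act1 loc_act_invX.
exact: (iter_cancel _ fK).
Qed.

Lemma tensor_evalK : cancel tensor_eval localize.
Proof. by move=> t; apply: tensor_eval_inj; rewrite localizeK. Qed.

Lemma iter_ad_f n y :
  iter n (@ad_f K L LL f) (env_loc_gen LL f y) = env_loc_gen LL f (iter n (br
    LL f) y).
Proof.
elim: n => //= n ->.
by rewrite /ad_f /env_loc_gen -!rmorphM -rmorphB env_gen_br.
Qed.

Lemma Theta_gen x n y : iter n (br LL f) y = 0 ->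
  Theta x (env_loc_gen LL f y) =
  \sum_(i < n) env_loc_cst LL f (binomial_coef x i) *
    env_loc_gen LL f (iter i (br LL f) y) * G ^+ i.
Proof.
move=> yn; rewrite /Theta; under [RHS]eq_bigr do rewrite -iter_ad_f.
rewrite (fsbig_ord _ n (fun i => env_loc_cst LL f (binomial_coef x i) *
    iter i (@ad_f K L LL f) (env_loc_gen LL f y) * G ^+ i)).
apply/esym/fsbig_widen => // i [_ /= /negP]; rewrite -leqNgt => le_ni.
by rewrite iter_ad_f (iter_linear_eq0 le_ni yn) /env_loc_gen env_gen0 rmorph0
  mulr0 mul0r.
Qed.

(** Here [NN] is the twist of [MM] by x, on the same space. In the application [MM] is already
    twisted and [NN] is the original module. *)
Lemma iso_twisted_localize (NN : superModule LL M) x :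
  (forall p m, mhom NN p m -> mhom MM p m) ->
  (forall n y m, iter n (br LL f) y = 0 ->
    \sum_(i < n) binomial_coef x i *:
      act MM (iter i (br LL f) y) (iter i g m) = act NN y m) ->
  iso_twisted f OO NN x.
Proof.
move=> homNM actNM; exists localize; split.
- exact: Bijective localizeK tensor_evalK.
- move=> k m n; apply: tensor_eval_inj.
  rewrite tensor_evalD tensor_evalZ !localizeK loc_act_in.
  by rewrite env_cst_act.
- move=> y m; apply: tensor_eval_inj; rewrite tensor_evalZ !localizeK.
  have [n yn] := nil_f y; rewrite -(actNM _ _ m yn) (Theta_gen x yn) loc_act_sum.
  apply: eq_bigr => i _; rewrite !loc_actM loc_act_invX !loc_act_in.
  by rewrite env_cst_act env_gen_act.
- move=> p m /homNM pm; rewrite /localize; case: cid => n Sm /=.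
  rewrite scale_tens mulr1 -[p]/(false (+) p); apply: loh_tens; last first.
    exact: mhom_iter_even.
  elim: n {Sm} => [|n IHn]; last first.
    by rewrite exprS -[false]/(false (+) false); apply: elh_mul => //;
      apply: elh_inv.
  (* The unit is even because it is the image of the scalar 1. *)
  rewrite expr0 -(rmorph1 j) -env_cst1; apply: elh_in; exact: eh_cst.
Qed.

End LocalizedSubmodule.

(** * Weights and strings *)

Section Weights.
Variables (K : numFieldType) (L : lmodType K) (LL : lieSuper L).
Variables (A : affinization LL) (H : {vspace fin_space A}).
Hypothesis cartan_H : fin_cartan H.
Implicit Types (la mu be : cartan_dual H) (a : cartan H).

Lemma cartan_in_even a : lhom LL false (cartan_in a).
Proof.
have subL := lhom_subspace LL false; have [H0 _ _ _] := cartan_H.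
have [sx ex] := H0 _ (subvsP a.1.1).
apply: subspaceD; rewrite //; last first.
  by apply: subspaceZ => //; apply: derivation_even.
apply: subspaceD => //; last by apply: subspaceZ => //; apply: central_even.
apply: loop_hom => //; rewrite /loop_space /= sx.
by rewrite expr0z scale1r.
Qed.

Lemma cartan_dual_scaleE k be a : (k *: be) a = k * be a.
Proof. by rewrite scale_lfunE. Qed.

Section Modules.
Variables (M : lmodType K) (MM : superModule LL M).
Implicit Types (v : M).
Local Notation wt := (weight_space (H := H) MM).

Lemma weight_subspace la : subspace (wt la).
Proof.
split=> [a|k u v lu lv a]; first by rewrite act0r scaler0.
by rewrite (act_bilinear MM).2 lu lv scalerDr !scalerA mulrC.
Qed.

Lemma weight_act la be x v :
  root_space be x -> wt la v -> wt (la + be) (act MM x v).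
Proof.
move=> bx lv a; rewrite act_comm_even; last exact: cartan_in_even.
by rewrite bx lv actZl linearZ -scalerDl add_lfunE addrC.
Qed.

Lemma weight_iter la be x n v :
  root_space be x -> wt la v -> wt (la + n%:R *: be) (iter n (act MM x) v).
Proof.
move=> bx lv; elim: n => [|n IHn]; first by rewrite scale0r addr0.
by rewrite iterS -natr1 scalerDl scale1r addrA; apply: weight_act.
Qed.

Lemma weight_decomposition v : weight_module H MM ->
  exists s (w : cartan_dual H -> M), [/\ uniq s, forall mu, wt mu (w mu)
    & v = \sum_(mu <- s) w mu].
Proof.
move=> /(_ v)[n [la [w [lw ->]]]]; rewrite (group_sum la w).
exists (undup [seq la i | i : 'I_n]), (fun mu => \sum_(i | la i == mu) w i).
split=> [|mu|//]; first exact: undup_uniq.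
have subW := weight_subspace mu; apply: subspace_sum => // i /eqP <-; exact: lw.
Qed.

(** The Cartan elements act on distinct weight spaces by distinct systems of eigenvalues, so a
    submodule contains the weight components of its vectors. *)
Lemma weight_component_mem (P : set M) s (w : cartan_dual H -> M) :
  submodule MM P -> uniq s -> (forall mu, wt mu (w mu)) ->
  P (\sum_(mu <- s) w mu) -> forall mu, mu \in s -> P (w mu).
Proof.
move=> sP us wmu; have subP := submodule_subspace sP.
apply: (@eigen_component _ _ _ _ (fun mu a => mu a : K)
  (fun a => act MM (cartan_in a))) => //.
- move=> mu nu e; exact/lfunP.
- by move=> a v; apply: sP.2.
- by move=> mu a _; apply: wmu.
Qed.

Lemma exists_weight_vector : weight_module H MM -> (exists v : M, v <> 0) ->
  exists la v, wt la v /\ v <> 0.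
Proof.
move=> wM [v v0]; apply: contrapT => nex; apply: v0.
have [s [w [_ lw ->]]] := weight_decomposition v wM.
rewrite big1 // => mu _; apply: contrapT => w0; apply: nex.
by exists mu, (w mu).
Qed.

Definition locally_nilpotent x : Prop := forall v, exists n, iter n (act MM x)
  v = 0.

(** The n-th power of x moves weight la to la + n be, where nothing is left for large n; a vector
    has finitely many components. *)
Lemma string_locally_nilpotent be x : weight_module H MM -> root_space be x ->
  (forall la, exists n0, forall n v, (n0 <= n)%N ->
    wt (la + n%:R *: be) v -> v = 0) ->
  locally_nilpotent x.
Proof.
move=> wM bx bd v; have [s [w [_ lw ->]]] := weight_decomposition v wM.
suff [n0 n0P] : exists n0, forall n, (n0 <= n)%N -> forall mu, mu \in s ->
    iter n (act MM x) (w mu) = 0.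
  exists n0; rewrite iter_linear_sum big_seq big1 // => mu; exact: n0P.
elim: s => [|mu s [n1 IHs]]; first by exists 0%N.
have [n2 mu0] := bd mu; exists (maxn n1 n2) => n.
rewrite geq_max => /andP[le1 le2] nu; rewrite inE => /predU1P[->|].
  by apply: mu0 le2 _; apply: weight_iter.
exact: IHs.
Qed.

(** * Strings of weights under an sl(2)-triple *)

Section SL2.
Variables (be : cartan_dual H) (e f : L) (a : cartan H).
Hypotheses (even_e : lhom LL false e) (even_f : lhom LL false f).
Hypotheses (root_e : root_space be e) (root_f : root_space (- be) f).
Hypotheses (br_ef : br LL e f = cartan_in a) (be_a : be a = 2).

Lemma sl2_comm la v : wt la v ->
  act MM e (act MM f v) = act MM f (act MM e v) + la a *: v.
Proof. by move=> lv; rewrite act_comm_even // br_ef lv addrC. Qed.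

Lemma weight_iter_f la n v :
  wt la v -> wt (la - n%:R *: be) (iter n (act MM f) v).
Proof. by move=> lv; rewrite -scalerN; apply: weight_iter. Qed.

Lemma sl2_iter la n v : wt la v -> act MM e (iter n.+1 (act MM f) v) =
  iter n.+1 (act MM f) (act MM e v) +
  (n.+1%:R * (la a - n%:R)) *: iter n (act MM f) v.
Proof.
move=> lv; elim: n => [|n IHn].
  by rewrite /= (sl2_comm lv) mul1r subr0.
rewrite iterS (sl2_comm (weight_iter_f _ lv)) IHn linearD linearZ /= -addrA.
congr (_ + _); rewrite -scalerDl; congr (_ *: _).
rewrite add_lfunE opp_lfunE cartan_dual_scaleE be_a -!natr1; ring.
Qed.

Hypothesis fin_M : forall la, exists n, dim_le (wt la) n.

(** A nonzero vector high on the string, raised by e as long as possible, gives a singular vector v.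
    Lowering it by f^i to the fixed weight la + k0 be gives an eigenvector of f e of eigenvalue mu
    i, and a finite dimensional space has room for finitely many of these. *)
Lemma string_bounded : locally_nilpotent e ->
  forall la, exists n0, forall n v, (n0 <= n)%N ->
    wt (la + n%:R *: be) v -> v = 0.
Proof.
move=> ln_e la.
have [k0 k0P] := addr_natS_neq0 (la a).
pose P := wt (la + k0%:R *: be).
(* With v of weight la + (k0 + i) be, f e f^i v = i (la(a) + 2 (k0 + i) - (i - 1)) f^i v. The offset
   k0 makes these values pairwise distinct. *)
pose mu i : K := i%:R * (la a + (k0 + k0 + i).+1%:R).
have mu_inj : injective mu.
  move=> i j /eqP; rewrite -subr_eq0.
  have -> : mu i - mu j = (i%:R - j%:R) * (la a + (k0 + k0 + (i + j)).+1%:R).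
    by rewrite /mu -!natr1 !natrD; ring.
  rewrite mulf_eq0 subr_eq0 eqr_nat => /orP[/eqP//|].
  by rewrite (negPf (k0P _ _)) // -addnA leq_addr.
have [d dP] := fin_M (la + k0%:R *: be).
pose T : {linear M -> M} := act MM f \o act MM e.
have [n0 n0P] := dim_le_finite_eigenvalues T dP mu_inj.
have singular i v : (n0 <= i)%N -> wt (la + (k0 + i)%:R *: be) v ->
    act MM e v = 0 -> v = 0.
  move=> le_i lv ev0.
  have ca : (la + (k0 + i)%:R *: be) a = la a + (k0 + k0 + i + i)%:R.
    by rewrite add_lfunE cartan_dual_scaleE be_a !natrD; ring.
  have : iter i (act MM f) v = 0.
    apply: (n0P i) => //.
      suff -> : la + k0%:R *: be = la + (k0 + i)%:R *: be - i%:R *: be.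
        exact: weight_iter_f.
      by rewrite natrD scalerDl addrA addrK.
    case: i le_i lv ca => [|i] le_i lv ca.
      by rewrite /mu mul0r scale0r /= ev0 linear0.
    rewrite /T -[LHS]/(act MM f (act MM e _)) (sl2_iter i lv) ev0.
    rewrite iter_linear0 add0r linearZ /=.
    congr (_ *: _); rewrite ca /mu; congr (_ * _).
    by rewrite -addrA; congr (_ + _); rewrite !addnS -!natr1 !natrD; ring.
  (* From f^i v = 0 down to v = 0: the factor by which e takes f^(j+1) v back to f^j v is nonzero by
     the choice of k0. *)
  suff desc j : (j <= i)%N -> iter j (act MM f) v = 0 -> v = 0 by apply: desc.
  elim: j => // j IHj lt_ji fj0; apply: IHj; first exact: ltnW.
  have := sl2_iter j lv; rewrite fj0 ev0 iter_linear0 linear0 add0r.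
  move/esym/eqP; rewrite scaler_eq0 mulf_eq0 pnatr_eq0 /= => /orP[|/eqP//].
  rewrite ca -addrA -natrB; last by rewrite (leq_trans (ltnW lt_ji)) ?leq_addl.
  suff -> : (k0 + k0 + i + i - j = (k0 + (k0 + i + (i - j.+1))).+1)%N.
    by rewrite (negPf (k0P _ _)) // leq_addr.
  lia.
exists (k0 + n0)%N => n v le_n lv; apply: contrapT => v0.
have exN := ln_e v; case: (ex_minnP (P := fun n => iter n (act MM e) v == 0)).
  by have [N eN] := exN; exists N; apply/eqP.
(* With N + 1 the least exponent such that e^(N+1) v = 0, the vector e^N v is nonzero and
   singular. *)
case=> [/eqP//|N] /eqP eN minN; have := minN N;
  rewrite ltnn => /contra_not/(_ notF).
apply; apply/eqP; apply: (singular (n + N - k0)%N) => //.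
  by lia.
rewrite subnKC; last by lia.
by rewrite natrD scalerDl addrA; apply: weight_iter.
Qed.

End SL2.
End Modules.
End Weights.

(** * Root vectors of affinizations *)

HB.instance Definition _ (K : fieldType) (L : lmodType K) (LL : lieSuper L)
    (A : affinization LL) j :=
  GRing.isLinear.Build K (fin_space A) L *:%R (loop A j) (@loop_linear K L LL A
    j).

Section Affinization.
Variables (K : numFieldType) (L : lmodType K) (LL : lieSuper L).
Variables (A : affinization LL) (H : {vspace fin_space A}).
Hypothesis cartan_H : fin_cartan H.
Local Notation g := (fin_space A).
Local Notation G := (fin_alg A).
Local Notation zeta := (zeta A).
Local Notation sg := (sigma A).
Local Notation gl j := (loop_space sg zeta j).
Implicit Types (be : cartan_dual H) (a b : cartan H) (j : int) (y h : g).

Lemma loop_subspace j : subspace (gl j).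
Proof.
split=> [|k u v uj vj]; rewrite /loop_space /= ?linear0 ?scaler0 //.
by rewrite linearP uj vj scalerDr !scalerA mulrC.
Qed.

Lemma cartan_sigma h : h \in H -> sg h = h.
Proof. by case: cartan_H => + _ _ _ => /(_ h) /[apply] -[]. Qed.

Lemma cartan_lhom h : h \in H -> lhom G false h.
Proof. by case: cartan_H => + _ _ _ => /(_ h) /[apply] -[]. Qed.

Lemma cartan_loop h : h \in H -> gl 0 h.
Proof. by move=> hH; rewrite /loop_space /= cartan_sigma // expr0z scale1r. Qed.

Lemma loop_space_br j h y : h \in H -> gl j y -> gl j (br G h y).
Proof.
by move=> hH yj; rewrite /loop_space /= sigma_br cartan_sigma // yj linearZ.
Qed.

Lemma br_central z : br LL z (central A) = 0.
Proof.
apply/eqP; rewrite -oppr_eq0 -br_skew_even ?central_br //; exact: central_even.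
Qed.

Lemma br_cartan_loop h j y : h \in H -> gl j y ->
  br LL (loop A 0 h) (loop A j y) = loop A j (br G h y).
Proof.
move=> hH yj; rewrite loop_br //; last exact: cartan_loop.
by rewrite add0r mul0r scale0r if_same addr0.
Qed.

Lemma br_cartan_derivation h : h \in H -> br LL (loop A 0 h) (derivation A) = 0.
Proof.
move=> hH; apply/eqP; rewrite -oppr_eq0 -br_skew_even;
  last exact: derivation_even.
by rewrite derivation_br ?scale0r //; apply: cartan_loop.
Qed.

(** The list in [loop_span] may repeat a degree; repetitions are absorbed as multiplicities, so that
    [loop_free] can be applied. *)
Lemma loop_normal_form z : exists (s : seq int) (x : int -> g) (r e : K),
  [/\ uniq s, forall j, gl j (x j) &
    z = \sum_(j <- s) loop A j (x j) + r *: central A + e *: derivation A].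
Proof.
have [s [x [r [e [xj ->]]]]] := loop_span A z.
exists (undup s), (fun j => x j *+ count_mem j s), r, e.
split=> [|j|]; first exact: undup_uniq.
  by rewrite -scaler_nat; apply: subspaceZ => //; apply: loop_subspace.
congr (_ + _ + _); rewrite -big_undup_iterop_count /=.
by apply: eq_bigr => j _; rewrite raddfMn.
Qed.

Lemma br_cartan_sum h s (x : int -> g) r e : h \in H -> (forall j, gl j (x j)) ->
  br LL (loop A 0 h)
    (\sum_(j <- s) loop A j (x j) + r *: central A + e *: derivation A) =
  \sum_(j <- s) loop A j (br G h (x j)).
Proof.
move=> hH xj; rewrite !linearD !linearZ /= br_central br_cartan_derivation //.
rewrite !scaler0 !addr0 linear_sum; apply: eq_bigr => j _.
exact: br_cartan_loop.
Qed.

(** A bracket with h has no component on the central element and the derivation, so for c nonzero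
    those coefficients of z vanish; the loop components are compared degree by degree. *)
Lemma cartan_eigen_components h c s (x : int -> g) r e : h \in H -> c != 0 ->
  uniq s -> (forall j, gl j (x j)) ->
  let z := \sum_(j <- s) loop A j (x j) + r *: central A + e *: derivation A in
  br LL (loop A 0 h) z = c *: z ->
  [/\ forall j, j \in s -> br G h (x j) = c *: x j, r = 0 & e = 0].
Proof.
move=> hH c0 us xj /=; rewrite br_cartan_sum // => e0.
have := @loop_free _ _ _ A s (fun j => br G h (x j) - c *: x j) (- (c * r)) (-
  (c * e)) us.
case=> [j||xs /eqP + /eqP].
- have subj := loop_subspace j; apply: subspaceB => //; last exact: subspaceZ.
  exact: loop_space_br.
- under eq_bigr do rewrite linearB linearZ /=.
  rewrite sumrB e0 -scaler_sumr !scalerDr !scaleNr !scalerA.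
  move: (c *: _) ((c * r) *: _) ((c * e) *: _) => X Y Z.
  by rewrite -[RHS](subrr (X + Y + Z)) !opprD !addrA.
rewrite !oppr_eq0 !mulf_eq0 (negPf c0) /= => /eqP -> /eqP ->; split=> // j js.
by apply/eqP; rewrite -subr_eq0 xs.
Qed.

Lemma cartan_eigenvector h c z : h \in H -> c != 0 -> z <> 0 ->
  br LL (loop A 0 h) z = c *: z -> exists y, y <> 0 /\ br G h y = c *: y.
Proof.
move=> hH c0 z0; have [s [x [r [e [us xj zE]]]]] := loop_normal_form z.
rewrite {}zE in z0 * => /(cartan_eigen_components hH c0 us xj)[hx r0 e0].
apply: contrapT => nex; apply: z0; rewrite r0 e0 !scale0r !addr0 big_seq big1 //.
move=> j js; suff -> : x j = 0 by rewrite linear0.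
by apply: contrapT => xj0; apply: nex; exists (x j); split=> //; apply: hx.
Qed.

Lemma dim_le_vect (V : vectType K) : dim_le [set: V] (\dim {:V}).
Proof.
exists (fun i => (vbasis {:V})`_i) => v _.
by exists (fun i => coord (vbasis {:V}) i v); rewrite -coord_vbasis ?memvf.
Qed.

(** Each application of ad x shifts the eigenvalue of ad h by c, while nonzero eigenvalues of ad h
    on L are already eigenvalues on the finite dimensional algebra. *)
Lemma ad_locally_nilpotent x h c : h \in H -> lhom LL false x -> c != 0 ->
  br LL (loop A 0 h) x = c *: x -> forall z, exists n, iter n (br LL x) z = 0.
Proof.
move=> hH ex c0 hx.
have eh : lhom LL false (loop A 0 h).
  by apply: loop_hom; [exact: cartan_loop|exact: cartan_lhom].
pose N := [set z | exists n, iter n (br LL x) z = 0].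
have subN : subspace N.
  split=> [|k u v [n un] [m vm]]; first by exists 0%N.
  exists (maxn n m); rewrite iter_linearP.
  rewrite (iter_linear_eq0 (leq_maxl n m) un) (iter_linear_eq0 (leq_maxr n m) vm).
  by rewrite scaler0 addr0.
have Neig d z : br LL (loop A 0 h) z = d *: z -> N z.
  move=> hz; pose mu n := d + n%:R * c.
  have hxz n : br LL (loop A 0 h) (iter n (br LL x) z) = mu n *: iter n (br LL
    x) z.
    elim: n => [|n IHn]; first by rewrite /mu mul0r addr0.
    rewrite iterS br_jacobi_even // hx IHn brZl linearZ -scalerDl; congr (_ *: _).
    by rewrite /mu -natr1; ring.
  have mu_inj : injective mu.
    by move=> n m /addrI/(mulIf c0)/eqP; rewrite eqr_nat => /eqP.
  have [n0 n0P] := dim_le_finite_eigenvalues (br G h) (dim_le_vect _) mu_inj.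
  (* The transfer to the finite dimensional algebra needs a nonzero eigenvalue; at most one of two
     consecutive values mu n is 0. *)
  have [n le_n mun] : exists2 n, (n0 <= n)%N & mu n != 0.
    have [mu0|] := eqVneq (mu n0) 0; last by exists n0.
    exists n0.+1 => //; apply/eqP => mu1.
    by have := mu_inj n0 n0.+1; rewrite mu1 mu0 => /(_ erefl)/n_Sn.
  exists n; apply: contrapT => z0.
  by have [y [y0 hy]] := cartan_eigenvector hH mun z0 (hxz n); apply/y0/(n0P n).
move=> z; suff : N z by [].
have [s [y [r [e [_ yj ->]]]]] := loop_normal_form z.
apply: subspaceD => //; last first.
  by apply: subspaceZ => //; apply: (Neig 0);
    rewrite br_cartan_derivation ?scale0r.
apply: subspaceD => //; last first.
  by apply: subspaceZ => //; apply: (Neig 0); rewrite br_central scale0r.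
apply: subspace_sum => // j _.
(* ad h is diagonalizable, and the eigencomponents of y j stay in the eigenspace of sigma of degree
   j. *)
have [_ _ diagH _] := cartan_H; have [n [w [a [yE hw]]]] := diagH h hH (y j).
have := diagonal_decomposition (T := br G h) (loop_subspace j) _ hw.
rewrite -yE => /(_ (fun v => @loop_space_br j h v hH) (yj j)) [t [u [-> hu uj]]].
rewrite linear_sum; apply: subspace_sum_mem => // d dt.
apply: (Neig d); rewrite br_cartan_loop //; last exact: uj.
by rewrite hu linearZ.
Qed.

Definition in_cartan (h : subvs_of H) : cartan H := (h, 0, 0).

Lemma br_cartan_in a j y : gl j y -> br LL (cartan_in a) (loop A j y) =
  loop A j (br G (vsval a.1.1) y) + (a.2 * j%:~R) *: loop A j y.
Proof.
move=> yj; rewrite /cartan_in !brDl !brZl central_br scaler0 addr0.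
rewrite br_cartan_loop ?derivation_br ?scalerA //; exact: subvsP.
Qed.

Lemma cartan_in_h (h : subvs_of H) : cartan_in (in_cartan h) = loop A 0 (vsval h).
Proof. by rewrite /cartan_in !scale0r !addr0. Qed.

Lemma cartan_dualE be a : be a =
  be (in_cartan a.1.1) + a.1.2 * be (0, 1, 0) + a.2 * be (0, 0, 1).
Proof.
have aE : a = in_cartan a.1.1 + a.1.2 *: ((0, 1, 0) : cartan H) +
    a.2 *: ((0, 0, 1) : cartan H).
  have ext u v : u.1.1 = v.1.1 -> u.1.2 = v.1.2 -> u.2 = v.2 -> u = v :> cartan H.
    by move: u v => [[? ?] ?] [[? ?] ?] /= -> -> ->.
  apply: ext; rewrite /= ?scaler0 ?addr0 ?add0r //; exact/esym/mulr1.
by rewrite [in LHS]aE !linearD !linearZ.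
Qed.

Lemma root_central be x : root_space be x -> x <> 0 -> be (0, 1, 0) = 0.
Proof.
move=> /(_ (0, 1, 0)) + x0.
rewrite /cartan_in /= linear0 scale1r scale0r addr0 add0r central_br => /esym/eqP.
by rewrite scaler_eq0 => /orP[/eqP//|/eqP].
Qed.

(** A root that does not vanish on H has its root vectors concentrated in one degree: the derivation
    separates the degrees, and its eigenvalue is the degree. *)
Lemma root_vector_loop be x (h0 : subvs_of H) : root_space be x -> x <> 0 ->
  be (in_cartan h0) != 0 -> exists j y, [/\ gl j y, x = loop A j y,
    be (0, 0, 1) = j%:~R &
    forall h : subvs_of H, br G (vsval h) y = be (in_cartan h) *: y].
Proof.
move=> bx x0 bh0; have [s [y [r [e [us yj xE]]]]] := loop_normal_form x.
have hx (h : subvs_of H) : br LL (loop A 0 (vsval h)) x = be (in_cartan h) *: x.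
  by rewrite -cartan_in_h bx.
have [_ r0 e0] : [/\ forall j, j \in s ->
  br G (vsval h0) (y j) = be (in_cartan h0) *: y j, r = 0 & e = 0].
  by apply: cartan_eigen_components => //; [exact: subvsP|rewrite -xE; exact: hx].
have {r0 e0}xE : x = \sum_(j <- s) loop A j (y j).
  by rewrite xE r0 e0 !scale0r !addr0.
have dx : br LL (derivation A) x = be (0, 0, 1) *: x.
  rewrite -(bx (0, 0, 1)) /cartan_in /= linear0 scale0r scale1r !add0r //.
have hyj j (h : subvs_of H) : j \in s ->
    br G (vsval h) (y j) = be (in_cartan h) *: y j.
  move=> js; apply/eqP; rewrite -subr_eq0; apply/eqP; move: j js.
  have := @loop_free _ _ _ A s (fun j => br G (vsval h) (y j) - be (in_cartan
    h) *: y j) 0 0 us.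
  case=> // [j|].
    have subj := loop_subspace j; apply: subspaceB => //; last exact: subspaceZ.
    by apply: loop_space_br => //; apply: subvsP.
  rewrite !scale0r !addr0; under eq_bigr do rewrite linearB linearZ /=.
  rewrite sumrB -scaler_sumr -xE -hx xE linear_sum.
  apply/eqP; rewrite subr_eq0; apply/eqP/eq_bigr => j _.
  by rewrite /= br_cartan_loop //; apply: subvsP.
have dyj j : j \in s -> (j%:~R - be (0, 0, 1)) *: y j = 0.
  move: j; have := @loop_free _ _ _ A s (fun j =>
    (j%:~R - be (0, 0, 1)) *: y j) 0 0 us.
  case=> // [j|]; first by have subj := loop_subspace j; apply: subspaceZ.
  rewrite !scale0r !addr0; under eq_bigr do rewrite linearZ /= scalerBl.
  rewrite sumrB -scaler_sumr -xE -dx xE linear_sum.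
  apply/eqP; rewrite subr_eq0; apply/eqP/eq_bigr => j _.
  by rewrite /= derivation_br.
have [j js yj0] : exists2 j, j \in s & y j <> 0.
  apply: contrapT => nex; apply: x0; rewrite xE big_seq big1 // => j js.
  suff -> : y j = 0 by rewrite linear0.
  by apply: contrapT => yj0; apply: nex; exists j.
have bj : be (0, 0, 1) = j%:~R.
  have /eqP := dyj j js; rewrite scaler_eq0 subr_eq0 => /orP[/eqP//|/eqP//].
exists j, (y j); split=> // [|h]; last exact: hyj.
rewrite xE (bigD1_seq j) //= big_seq_cond big1 ?addr0 // => i /andP[is_ ne_ij].
have /eqP := dyj i is_; rewrite scaler_eq0 bj subr_eq0 eqr_int (negPf ne_ij) /=.
by move/eqP ->; rewrite linear0.
Qed.

(** Since sigma is even, both parity components of y lie in its eigenspace, where [loop] is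
    injective and preserves parity. *)
Lemma sigma_loop_hom j p y : gl j y -> lhom LL p (loop A j y) -> lhom G p y.
Proof.
move=> yj py; have [y0 [y1 [e0 o1 yE]]] := lhomP G y.
have y0j : gl j y0.
  apply/eqP; rewrite -subr_eq0; apply/eqP.
  have sub_lhom q := lhom_subspace G q.
  apply: (@lhom_disjoint _ _ G).
    by apply: subspaceB => //; [exact: sigma_hom|exact: subspaceZ].
  have -> : sg y0 - zeta ^ j *: y0 = - (sg y1 - zeta ^ j *: y1).
    apply/eqP; rewrite -addr_eq0 addrACA -opprD -scalerDr -linearD -yE.
    by rewrite yj subrr.
  apply: subspaceN => //; apply: subspaceB => //;
    [exact: sigma_hom|exact: subspaceZ].
have y1j : gl j y1.
  by rewrite -[y1](addKr y0) -yE addrC; have subj := loop_subspace j;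
    apply: subspaceB.
have loop0 y' : gl j y' -> loop A j y' = 0 -> y' = 0.
  move=> y'j l0; have := @loop_free _ _ _ A [:: j] (fun i =>
    if i == j then y' else 0) 0 0.
  case=> // [i||/(_ j)].
  - by case: eqP => [->//|_]; exact: (subspace0 (loop_subspace i)).
  - by rewrite big_seq1 eqxx l0 !scale0r !addr0.
  - by rewrite mem_head eqxx => ->.
have [l0 l1] := (loop_hom y0j e0, loop_hom y1j o1).
have subL q := lhom_subspace LL q.
case: p py; rewrite yE linearD /= => py.
  rewrite [y0]loop0 ?add0r //; apply: (@lhom_disjoint _ _ LL) => //.
  by rewrite -[loop A j y0](addrK (loop A j y1)); apply: subspaceB.
rewrite [y1]loop0 ?addr0 //; apply: (@lhom_disjoint _ _ LL) => //.
by rewrite -[loop A j y1](addKr (loop A j y0)) addrC; apply: subspaceB.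
Qed.

Lemma zeta_neq0 : zeta != 0.
Proof.
apply: contra_eq_neq (prim_expr_order (zeta_root A)) => ->.
by rewrite expr0n gtn_eqF ?(prim_order_gt0 (zeta_root A)) // eq_sym oner_eq0.
Qed.

(** * The invariant form and opposite root vectors *)

Lemma kappaPr x k y z :
  kappa A x (k *: y + z) = k * kappa A x y + kappa A x z.
Proof. by case: (kappa_form A) => -[_ lin] _ _ _ _; apply: lin. Qed.

Lemma kappaDr x y z : kappa A x (y + z) = kappa A x y + kappa A x z.
Proof. by rewrite -[y]scale1r kappaPr !scale1r mul1r. Qed.

Lemma kappa0r x : kappa A x 0 = 0.
Proof. by apply: (addrI (kappa A x 0)); rewrite -kappaDr !addr0. Qed.

Lemma kappaZr x k y : kappa A x (k *: y) = k * kappa A x y.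
Proof. by rewrite -[k *: y]addr0 kappaPr kappa0r addr0. Qed.

Lemma kappa_sumr x I (r : seq I) (F : I -> g) :
  kappa A x (\sum_(i <- r) F i) = \sum_(i <- r) kappa A x (F i).
Proof.
by elim: r => [|i r IHr]; rewrite ?big_nil ?kappa0r // !big_cons kappaDr IHr.
Qed.

Lemma kappaPl k x y z :
  kappa A (k *: x + y) z = k * kappa A x z + kappa A y z.
Proof. by case: (kappa_form A) => -[lin _] _ _ _ _; apply: lin. Qed.

Lemma kappaDl x y z : kappa A (x + y) z = kappa A x z + kappa A y z.
Proof. by rewrite -[x]scale1r kappaPl !scale1r mul1r. Qed.

Lemma kappa0l y : kappa A 0 y = 0.
Proof. by apply: (addrI (kappa A 0 y)); rewrite -kappaDl !addr0. Qed.

Lemma kappaZl k x y : kappa A (k *: x) y = k * kappa A x y.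
Proof. by rewrite -[k *: x]addr0 kappaPl kappa0l addr0. Qed.

Lemma kappaNl x y : kappa A (- x) y = - kappa A x y.
Proof. by rewrite -scaleN1r kappaZl mulN1r. Qed.

Lemma kappa_even_sym x y : lhom G false x -> lhom G false y ->
  kappa A x y = kappa A y x.
Proof.
move=> ex ey; have [_ _ sym _ _] := kappa_form A.
by rewrite (sym _ _ _ _ ex ey) /= mul1r.
Qed.

Lemma kappa_invariant x y z : kappa A (br G x y) z = kappa A x (br G y z).
Proof. by case: (kappa_form A). Qed.

(** With q = zeta^j, the average sum_i q^i sigma^i(z) lies in degree - j, and by invariance each
    summand pairs with y as z does; the total is the order of sigma times kappa(y, z). *)
Lemma kappa_sigma_average j p y z : gl j y -> lhom G p z -> kappa A y z != 0 ->
  exists z', [/\ gl (- j) z', lhom G p z' & kappa A y z' != 0].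
Proof.
move=> yj pz yz0; pose m := sigma_order A; pose q := zeta ^ j.
have m0 : (0 < m)%N := prim_order_gt0 (zeta_root A).
have qm : q ^+ m = 1.
  by rewrite /q exprnP exprzAC -exprnP (prim_expr_order (zeta_root A)) exp1rz.
have q0 : q != 0 by rewrite expfz_neq0 // zeta_neq0.
have ks w : q * kappa A y (sg w) = kappa A y w.
  by rewrite -(sigma_kappa y w) yj kappaZl.
have ksi i w : q ^+ i * kappa A y (iter i sg w) = kappa A y w.
  elim: i w => [|i IHi] w; first by rewrite mul1r.
  by rewrite exprSr -mulrA ks IHi.
exists (\sum_(i < m) q ^+ i *: iter i sg z); split.
- apply: (scalerI q0); rewrite scalerA -invr_expz -/q mulfV // scale1r.
  rewrite linear_sum scaler_sumr -(big_mkord xpredT (fun i =>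
    q ^+ i *: iter i sg z)).
  have := telescope_sumr (fun i => q ^+ i *: iter i sg z) (leq0n m).
  rewrite qm sigma_finite subrr sumrB => /eqP; rewrite subr_eq0 => /eqP <-.
  by rewrite big_mkord; apply: eq_bigr => i _; rewrite linearZ scalerA -exprS.
- have subp := lhom_subspace G p; apply: subspace_sum => // i _.
  apply: subspaceZ => //; elim: (nat_of_ord i) => //= k; exact: sigma_hom.
- rewrite kappa_sumr (eq_bigr (fun=> kappa A y z)); last first.
    by move=> i _; rewrite kappaZr ksi.
  by rewrite sumr_const card_ord -mulr_natl mulf_neq0 // pnatr_eq0 -lt0n.
Qed.

(* Splitting z into eigenvectors of ad h one h at a time: by invariance of
   kappa only the component of eigenvalue - c h pairs nontrivially with y. *)
Lemma kappa_weight_component j p y z (c : subvs_of H -> K) :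
  (forall h : subvs_of H, br G (vsval h) y = c h *: y) ->
  gl j z -> lhom G p z -> kappa A y z != 0 -> forall s : seq (subvs_of H),
  exists z', [/\ gl j z', lhom G p z', kappa A y z' != 0 &
    forall h : subvs_of H, h \in s -> br G (vsval h) z' = - c h *: z'].
Proof.
move=> hy zj pz yz0; elim=> [|h0 s [u [uj pu yu0 hu]]]; first by exists z.
have H0 (h : subvs_of H) : vsval h \in H := subvsP h.
pose P := [set w | [/\ gl j w, lhom G p w &
  forall h : subvs_of H, h \in s -> br G (vsval h) w = - c h *: w]].
have subP : subspace P.
  have [subj subp] := (loop_subspace j, lhom_subspace G p).
  split=> [|k v w [vj pv hv] [wj pw hw]].
    split=> [||h _]; [exact: subspace0|exact: subspace0|].
    by rewrite linear0 scaler0.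
  split=> [||h hs]; [exact: subj.2|exact: subp.2|].
  by rewrite linearP /= hv // hw // scalerDr !scalerA mulrC.
have PT w : P w -> P (br G (vsval h0) w).
  move=> [wj pw hw]; split=> [||h hs].
  - exact: loop_space_br.
  - by apply: lhom_br_even => //; apply: cartan_lhom.
  - rewrite br_jacobi_even; last exact: cartan_lhom.
    have [_ abH _ _] := cartan_H;
      rewrite (abH _ _ (H0 h) (H0 h0)) br0l add0r hw //.
    by rewrite linearZ.
have [_ _ diagH _] := cartan_H.
have [n [w [a [uE hw]]]] := diagH (vsval h0) (H0 _) u.
have := diagonal_decomposition (T := br G (vsval h0)) subP PT hw.
rewrite -uE => -[]; first by split.
move=> t [v [uE' hv Pv]].
have [d dt yd] : exists2 d, d \in t & kappa A y (v d) != 0.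
  apply: contrapT => nex; move: yu0; rewrite uE' kappa_sumr big_seq big1 ?eqxx //.
  move=> d dt; apply/eqP; apply: contrapT => /negP yd; apply: nex; by exists d.
have [vj pv hs] := Pv d dt; exists (v d); split=> // h.
rewrite inE => /predU1P[->|]; last exact: hs.
rewrite hv; congr (_ *: _); apply: (mulIf yd).
have yh : br G y (vsval h0) = - br G (vsval h0) y.
  by rewrite (br_skew_even y (cartan_lhom (H0 h0))) opprK.
by rewrite -kappaZr -hv -kappa_invariant yh hy kappaNl kappaZl mulNr.
Qed.

(** What a real root provides: a vector v representing be, with be(v) nonzero. It is stated for
    weights so that it passes to 2 be. *)
Definition nondegenerate_weight be :=
  exists v : cartan H, (forall b, cartan_form v b = be b) /\ be v != 0.

Lemma real_root_nondegenerate be : real_root be -> nondegenerate_weight be.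
Proof.
case=> _; rewrite /dual_form; set v := cartan_vector be => bv.
have [ex|nex] := pselect (exists v : cartan H, forall b, cartan_form v b = be b).
  have vP : forall b, cartan_form v b = be b.
    exact: (xgetPex 0 (P := [set v | forall b, cartan_form v b = be b])).
  by exists v; split=> //; rewrite -vP; apply/eqP.
(* Without a representing vector, [cartan_vector] takes its default value 0, and (be, be) would be
   0. *)
case: bv; have -> : v = 0.
  by apply: xgetPN => u uP; apply: nex; exists u.
rewrite -[0 : cartan H]/((0, 0, 0) : cartan H) /cartan_form /=.
by rewrite kappa0r !mulr0 !addr0.
Qed.

Lemma nondegenerate_weightMn2 be :
  nondegenerate_weight be -> nondegenerate_weight (2%:R *: be).
Proof.
move=> [v [vP bv]]; exists (2%:R *: v); split=> [b|].
  rewrite cartan_dual_scaleE -vP /cartan_form /= kappaZl.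
  by rewrite !mulrDr !mulrA.
by rewrite cartan_dual_scaleE linearZ /= !mulf_neq0 // pnatr_eq0.
Qed.

(** A root vanishes on the central element, so the representing vector has no component on the
    derivation, and be takes the same nonzero value on its component in H. *)
Lemma nondegenerate_weight_cartan be x : nondegenerate_weight be ->
  root_space be x -> x <> 0 -> exists v : subvs_of H,
  be (in_cartan v) != 0 /\
  forall h : subvs_of H, kappa A (vsval v) (vsval h) = be (in_cartan h).
Proof.
move=> [v [vP bv]] bx x0; have b1 := root_central bx x0; exists v.1.1; split.
  have := vP (0, 1, 0);
    rewrite b1 /cartan_form /= kappa0r mulr0 mulr1 !add0r => v2.
  by move: bv; rewrite cartan_dualE b1 v2 mulr0 mul0r !addr0.
by move=> h; rewrite -vP /cartan_form /= !mulr0 !addr0.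
Qed.

(** Write e = y (x) t^j. Nondegeneracy gives a partner z of y, which is refined to the right parity,
    degree and weight. Then [y, z] is even, fixed by sigma and centralizes H, so it lies in H. *)
Lemma opposite_root_vector be p e : nondegenerate_weight be ->
  root_space be e -> lhom LL p e -> e <> 0 ->
  exists f a, [/\ lhom LL p f, root_space (- be) f, br LL e f = cartan_in a &
    be a != 0].
Proof.
move=> nd be_e pe e0; have [v [bv vP]] := nondegenerate_weight_cartan nd be_e e0.
have [j [y [yj eE bj hy]]] := root_vector_loop be_e e0 bv.
have b1 := root_central be_e e0.
have py : lhom G p y by apply: (sigma_loop_hom yj); rewrite -eE.
have y0 : y <> 0 by move=> y0; apply: e0; rewrite eE y0 linear0.
have [_ odd0 sym _ nondeg] := kappa_form A.
have [z yz0] : exists z, kappa A y z != 0.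
  apply: contrapT => nex; apply: y0; apply: nondeg => z; apply: contrapT => yz.
  by apply: nex; exists z; apply/eqP.
have [z0 pz0 {z}yz0] : exists2 z0, lhom G p z0 & kappa A y z0 != 0.
  have [z0 [z1 [ez oz zE]]] := lhomP G z; move: yz0; rewrite zE kappaDr.
  case: (p) py => py; last by rewrite [kappa A y z1]odd0 // addr0 => yz;
    exists z0.
  by rewrite (sym _ _ _ _ py ez) /= mul1r [kappa A z0 y]odd0 // add0r => yz;
    exists z1.
have [z1 [z1j pz1 yz1]] := kappa_sigma_average yj pz0 yz0.
have [z [zj pz yz hz]] := kappa_weight_component hy z1j pz1 yz1 (vbasis
  {:subvs_of H}).
(* The weight condition was obtained on a basis of H; it is linear in h. *)
have {}hz (h : subvs_of H) : br G (vsval h) z = - be (in_cartan h) *: z.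
  pose P := [set h : subvs_of H | br G (vsval h) z = - be (in_cartan h) *: z].
  have subP : subspace P.
    have beP k u w : be (in_cartan (k *: u + w)) = k * be (in_cartan u) + be
      (in_cartan w).
      suff -> : in_cartan (k *: u + w) = k *: in_cartan u + in_cartan w.
        by rewrite linearP.
      by rewrite /in_cartan; congr (_, _, _); rewrite /= ?scaler0 ?addr0.
    split=> [|k u w]; rewrite /P /=.
      by rewrite linear0 br0l oppr0 scale0r.
    rewrite beP (br_bilinear G).1 => -> ->.
    by rewrite scalerA -scalerDl opprD mulrN.
  suff : P h by [].
  rewrite (coord_vbasis (memvf h)); apply: subspace_sum => // i _.
  by apply: subspaceZ => //; apply: hz; rewrite mem_nth // size_tuple.
have yzH : br G y z \in H.
  have [_ _ _ centH] := cartan_H; apply: centH.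
  - rewrite sigma_br yj zj brZl linearZ scalerA -expfzDr ?addrN ?scale1r //.
    exact: zeta_neq0.
  - by case: (p) py pz => py pz; exact: (br_lhom py pz).
  - move=> x xH; rewrite br_jacobi_even; last exact: cartan_lhom.
    have := hy (vsproj H x); have := hz (vsproj H x); rewrite vsprojK // => -> ->.
    by rewrite brZl linearZ -scalerDl addrN scale0r.
(* This is be([e, f]) up to notation, as v represents be; both factors on the right are nonzero. *)
have v0 : kappa A (vsval v) (br G y z) = be (in_cartan v) * kappa A y z.
  rewrite kappa_even_sym; [|exact/cartan_lhom/subvsP|exact: cartan_lhom].
  rewrite kappa_invariant (_ : br G z (vsval v) = - br G (vsval v) z); last first.
    by rewrite (br_skew_even z (cartan_lhom (subvsP v))) opprK.
  by rewrite hz scaleNr opprK kappaZr.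
pose a : cartan H := (vsproj H (br G y z), j%:~R * kappa A y z, 0).
exists (loop A (- j) z), a; split.
- exact: loop_hom.
- move=> b; rewrite br_cartan_in // hz linearZ -scalerDl opp_lfunE.
  rewrite (cartan_dualE be b) b1 bj mulr0 addr0 opprD mulrNz mulrN.
  by congr (_ *: _).
- by rewrite eE loop_br // addrN eqxx /cartan_in /a /= vsprojK // scale0r addr0.
- rewrite (cartan_dualE be a) b1 mulr0 addr0 mul0r addr0 /a /= -vP vsprojK // v0.
  exact: mulf_neq0.
Qed.

Lemma sl2_triple be e : nondegenerate_weight be ->
  root_space be e -> lhom LL false e -> e <> 0 ->
  exists f a, [/\ lhom LL false f, root_space (- be) f, br LL e f = cartan_in a &
    be a = 2].
Proof.
move=> nd be_e ee e0;
  have [f [a [ef bf efa ba]]] := opposite_root_vector nd be_e ee e0.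
exists ((2 / be a) *: f), ((2 / be a) *: a); split.
- by apply: subspaceZ => //; apply: lhom_subspace.
- by move=> b; rewrite linearZ /= bf !scalerA mulrC.
- by rewrite linearZ /= efa /cartan_in /= linearZ /= !scalerDr !scalerA.
- by rewrite linearZ; exact: divfK.
Qed.

Lemma even_root_ad_nilpotent be e : nondegenerate_weight be ->
  root_space be e -> lhom LL false e -> forall z, exists n, iter n (br LL e) z
    = 0.
Proof.
move=> nd be_e ee; have [->|/eqP e0] := eqVneq e 0.
  by move=> z; exists 1%N; rewrite /= br0l.
have [v [bv _]] := nondegenerate_weight_cartan nd be_e e0.
apply: (ad_locally_nilpotent (subvsP v) ee bv).
by rewrite -cartan_in_h be_e.
Qed.

(** If [x, x] = 0, the Jacobi identity with an opposite vector y gives 2 [x, [x, y]] = 0, whereas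
    [x, [x, y]] is a nonzero multiple of x. *)
Lemma odd_root_square be x : nondegenerate_weight be ->
  root_space be x -> lhom LL true x -> x <> 0 ->
  [/\ root_space (2%:R *: be) (br LL x x), lhom LL false (br LL x x) & br LL x
    x <> 0].
Proof.
move=> nd be_x ox x0; split; last 1 first.
- have [y [a [oy by_ xya ba]]] := opposite_root_vector nd be_x ox x0.
  move=> xx; have := br_jacobi y ox ox; rewrite xx br0l add0r /= scaleN1r.
  rewrite xya => /eqP; rewrite -addr_eq0 -mulr2n.
  have -> : br LL x (cartan_in a) = - (be a *: x).
    by rewrite -be_x (br_skew_even x (cartan_in_even cartan_H a)) opprK.
  by rewrite -scaler_nat scalerN oppr_eq0 scalerA scaler_eq0 mulf_eq0 pnatr_eq0
    (negPf ba) /= => /eqP.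
- move=> a; rewrite br_jacobi_even; last exact: cartan_in_even.
  by rewrite be_x brZl linearZ -scalerDl cartan_dual_scaleE mulr_natl mulr2n.
- exact: (br_lhom ox ox).
Qed.

End Affinization.

(** * The socle of the twisted module *)

Section WeightSubmodules.
Variables (K : numFieldType) (L : lmodType K) (LL : lieSuper L).
Variables (A : affinization LL) (H : {vspace fin_space A}).
Variables (M : lmodType K) (MM : superModule LL M) (P : set M).
Variable sP : submodule MM P.
Local Notation OO := (sub_superModule sP).
Implicit Type la : cartan_dual H.

Lemma sub_weight_space la u :
  weight_space OO la u <-> weight_space MM la (subcarrier_val u).
Proof.
split=> lu a; first by rewrite -[LHS]/(subcarrier_val (act OO (cartan_in a) u))
  lu.
apply: val_inj; exact: lu.
Qed.

Lemma sub_dim_le la n :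
  dim_le (weight_space MM la) n -> dim_le (weight_space OO la) n.
Proof.
have subPW := subspaceI (submodule_subspace sP) (weight_subspace MM la).
have subset : P `&` weight_space MM la `<=` weight_space MM la by move=> v [].
move=> /(dim_le_subset subPW subset)[e [eP espan]].
exists (fun i => in_subcarrier sP (eP i).1) => u /sub_weight_space lu.
have [|c uE] := espan (subcarrier_val u); first by split=> //; apply: subcarrierP.
by exists c; apply: val_inj; rewrite /= uE raddf_sum; apply: eq_bigr.
Qed.

Lemma sub_weight_module : weight_module H MM -> weight_module H OO.
Proof.
move=> wM u; have [s [w [us lw uE]]] := weight_decomposition (subcarrier_val u)
  wM.
have Pu : P (\sum_(mu <- s) w mu) by rewrite -uE; apply: subcarrierP.
have Pw := weight_component_mem sP us lw Pu.
pose w' mu := xget 0 [set v : subcarrier sP | subcarrier_val v = w mu].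
have w'E mu : mu \in s -> subcarrier_val (w' mu) = w mu.
  move=> mus; apply: (@xgetPex _ 0 [set v : subcarrier sP | subcarrier_val v =
    w mu]).
  by exists (in_subcarrier sP (Pw _ mus)).
exists (size s), (fun i => nth 0 s i), (fun i => w' (nth 0 s i)); split=> [i|].
  by apply/sub_weight_space; rewrite w'E ?mem_nth //; apply: lw.
apply: val_inj; rewrite /= uE raddf_sum (big_nth 0) big_mkord.
by apply: eq_bigr => i _ /=; rewrite w'E ?mem_nth.
Qed.

Lemma sub_admissible : admissible H MM -> admissible H OO.
Proof.
move=> [[wM fM] [n bM] [mu cM]]; split; [split|exists n|exists mu].
- exact: sub_weight_module.
- by move=> la; have [m dm] := fM la; exists m; apply: sub_dim_le.
- by move=> la; apply: sub_dim_le.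
- move=> la [u [/sub_weight_space lu u0]]; apply: cM; exists (subcarrier_val u).
  by split=> // v0; apply: u0; apply: val_inj.
Qed.

End WeightSubmodules.

(** * Weights and minimal submodule of the twisted module *)

Section TwistedWeights.
Variables (K : numFieldType) (L : lmodType K) (LL : lieSuper L).
Variables (A : affinization LL) (H : {vspace fin_space A}).
Hypothesis cartan_H : fin_cartan H.
Variables (al : cartan_dual H) (e f : L) (a : cartan H).
Hypotheses (even_e : lhom LL false e) (even_f : lhom LL false f).
Hypotheses (root_e : root_space al e) (root_f : root_space (- al) f).
Hypotheses (br_ef : br LL e f = cartan_in a) (al_a : al a = 2).
Hypotheses (nil_e : forall y, exists n, iter n (br LL e) y = 0)
  (nil_f : forall y, exists n, iter n (br LL f) y = 0).
Variables (M : lmodType K) (MM : superModule LL M).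
Implicit Types (x : K) (v w : M) (la : cartan_dual H).

Section FiniteWeights.
Hypotheses (weight_M : weight_module H MM)
  (fin_M : forall la, exists n, dim_le (weight_space MM la) n)
  (inj_e : injective (act MM e)) (inj_f : injective (act MM f)).

(** On each weight space f e is injective, so w is a combination of the (f e)^i w with i > 0, which
    lie in the image of f. *)
Lemma lowering_surjective v : exists w, act MM f w = v.
Proof.
pose Q := [set v | exists w, act MM f w = v].
have subQ : subspace Q.
  split=> [|k _ _ [u <-] [w <-]]; first by exists 0; rewrite act0r.
  by exists (k *: u + w); rewrite linearP.
suff : Q v by [].
have [s [w [_ lw ->]]] := weight_decomposition v weight_M.
apply: subspace_sum => // mu _; have [n dn] := fin_M mu.
apply: (@dim_le_mem_image _ _ (act MM f \o act MM e) _ _ _ _ dn) => //=.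
- exact: weight_subspace.
- move=> u mu_u; rewrite -[mu](addrK al); apply: weight_act => //.
  exact: weight_act.
- by move=> u _ u0; apply/inj_e/inj_f; rewrite !act0r.
- by move=> u _; exists (act MM e u).
- by exists (act MM e (w mu)).
Qed.

Lemma lowering_inverse : exists g : {linear M -> M},
  cancel (act MM f) g /\ cancel g (act MM f).
Proof.
pose g v := xget 0 [set w | act MM f w = v].
have gK : cancel g (act MM f).
  by move=> v; apply: (@xgetPex _ 0 [set w | act MM f w = v]);
    apply: lowering_surjective.
have fK : cancel (act MM f) g by move=> v; apply: inj_f; rewrite gK.
have g_lin : linear g by move=> k u v; apply: inj_f;
  rewrite (act_bilinear MM).2 !gK.
pose G : {linear M -> M} := HB.pack g (GRing.isLinear.Build K M M *:%R g g_lin).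
by exists G.
Qed.

End FiniteWeights.

Variable g : {linear M -> M}.
Hypotheses (fK : cancel (act MM f) g) (gK : cancel g (act MM f)).
Local Notation TW x := (twist even_f nil_f fK gK x).

(** As [f, b] = al(b) f, the twist translates the weights by x al. *)
Lemma twist_cartan x b v : act (TW x) (cartan_in b) v =
  act MM (cartan_in b) v + (x * al b) *: v.
Proof.
apply: twist_act_eigen; rewrite br_skew_even // root_f.
by rewrite opp_lfunE scaleNr opprK.
Qed.

Lemma twist_weight_space x la v :
  weight_space (TW x) la v <-> weight_space MM (la - x *: al) v.
Proof.
split=> lv b; have := lv b;
  rewrite twist_cartan add_lfunE opp_lfunE cartan_dual_scaleE.
  by move/(canRL (addrK _)) => ->; rewrite scalerBl.
by move=> ->; rewrite -scalerDl subrK.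
Qed.

Lemma twist_weight_spaceE x la :
  weight_space (TW x) la = weight_space MM (la - x *: al).
Proof. by apply/seteqP; split=> v /twist_weight_space. Qed.

Lemma twist_admissible x : admissible H MM -> admissible H (TW x).
Proof.
move=> [[wM fM] [n bM] [mu cM]]; split; [split|exists n|exists (mu + x *: al)].
- move=> v; have [m [la [w [lw vE]]]] := wM v.
  exists m, (fun i => la i + x *: al), w; split=> // i.
  by apply/twist_weight_space; rewrite addrK.
- by move=> la; rewrite twist_weight_spaceE.
- by move=> la; rewrite twist_weight_spaceE.
- move=> la [v [/twist_weight_space lv v0]]; rewrite opprD addrA addrAC.
  by apply: cM; exists v.
Qed.

Lemma twist_level_zero x : level_zero A MM -> level_zero A (TW x).
Proof.
move=> z v; rewrite (@twist_act_eigen _ _ _ _ _ _ _ _ _ _ _ _ 0); last first.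
  by rewrite scale0r br_central.
by rewrite z mulr0 scale0r addr0.
Qed.

Lemma twist_iter_self x n v : iter n (act (TW x) f) v = iter n (act MM f) v.
Proof. by elim: n => // n IHn; rewrite iterS IHn twist_act_self. Qed.

Hypothesis simple_M : simple_module MM.

(** The f-saturation of N is stable under g and under the twisted action, hence under the original
    action by [twist_act_opp]; simplicity of M makes it everything. *)
Lemma twist_saturation x (N : set M) : submodule (TW x) N ->
  (exists v, N v /\ v <> 0) -> forall v, exists n, N (iter n (act MM f) v).
Proof.
move=> sN [v0 [Nv0 v00]].
have sD := submodule_saturation nil_f even_f sN.
set D := saturation _ _ _ in sD.
have DP v : D v <-> exists n, N (iter n (act MM f) v).
  by split=> -[n]; rewrite ?twist_iter_self => Nv; exists n;
    rewrite ?twist_iter_self.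
have Dg v : D v -> D (g v).
  move=> /DP[n Nv]; apply/DP; exists n.+1; by rewrite iterSr gK.
have Dgi n v : D v -> D (iter n g v) by move=> Dv; elim: n => //= n; apply: Dg.
have Dact y v : D v -> D (act MM y v).
  move=> Dv; have [n yn] := nil_f y.
  rewrite -(twist_act_opp even_f nil_f fK gK x v yn).
  have subD := submodule_subspace sD; apply: subspace_sum => // i _.
  by apply: subspaceZ => //; apply: sD.2; apply: Dgi.
case: simple_M => _ /(_ D sD.1 Dact)[D0|DT] v; last exact/DP.
by case: v00; apply: D0; apply/DP; exists 0%N.
Qed.

(** The intersection of all nonzero graded submodules; once shown to be nonzero, it is the unique
    minimal one. *)
Definition socle x : set M := [set v | forall N : set M, submodule (TW x) N ->
  (exists w, N w /\ w <> 0) -> N v].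

Lemma socle_submodule x : submodule (TW x) (socle x).
Proof.
split; last by move=> y v Sv N sN N0; apply: sN.2; apply: Sv.
split; first split.
- by move=> N sN _; apply: subspace0 (submodule_subspace sN).
- move=> k u v Su Sv N sN N0; apply: (submodule_subspace sN).2.
    exact: Su.
  exact: Sv.
- move=> v0 v1 e0 o1 Sv; split=> N sN N0; have := Sv N sN N0.
    by case/(sN.1.2 _ _ e0 o1).
  by case/(sN.1.2 _ _ e0 o1).
Qed.

Hypothesis fin_M : forall la, exists n, dim_le (weight_space MM la) n.

Lemma inverse_weight x la n v : weight_space (TW x) (la - n%:R *: al) v ->
  weight_space (TW x) la (iter n g v).
Proof.
have inj_f := can_inj fK.
have one mu u : weight_space (TW x) mu u -> weight_space (TW x) (mu + al) (g u).
  move=> /twist_weight_space lu; apply/twist_weight_space => b; apply: inj_f.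
  have := act_br_even MM f (g u) (cartan_in_even cartan_H b).
  rewrite root_f gK lu actZl gK => fu; rewrite actZr gK.
  have -> : act MM f (act MM (cartan_in b) (g u)) =
      (mu - x *: al) b *: u - (- al) b *: u by rewrite fu opprB addrC subrK.
  by rewrite -scalerBl !(add_lfunE, opp_lfunE) opprK addrAC.
suff main mu : weight_space (TW x) mu v ->
    weight_space (TW x) (mu + n%:R *: al) (iter n g v).
  by move=> /main; rewrite subrK.
move=> mu_v; elim: n => [|n IHn]; first by rewrite scale0r addr0.
by rewrite -natr1 scalerDl scale1r addrA; apply/one.
Qed.

(** If e kills u = f^(m+1) w with w in a fixed weight space, then cancelling f^m leaves w as an
    eigenvector of f e of eigenvalue - (m+1) (c - m). For large m these values are distinct, and
    finitely many of them occur. *)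
Lemma exists_raising_injective_string x : weight_module H MM ->
  exists la, (exists v, weight_space (TW x) la v /\ v <> 0) /\
    forall n u, weight_space (TW x) (la - n.+1%:R *: al) u ->
      act (TW x) e u = 0 -> u = 0.
Proof.
move=> wM; have [mu0 [v0 [mu_v0 v00]]] := exists_weight_vector wM simple_M.1.
pose mu := mu0 + x *: al.
have {}mu_v0 : weight_space (TW x) mu v0 by apply/twist_weight_space;
  rewrite addrK.
have [d dW] : exists d, dim_le (weight_space (TW x) mu) d.
  by rewrite twist_weight_spaceE.
pose c := mu a.
have [k0 k0P] := addr_natS_neq0 (- c).
pose ev i : K := - ((k0 + i).+1%:R * (c - (k0 + i)%:R)).
have ev_inj : injective ev.
  move=> i j /eqP; rewrite -subr_eq0.
  have -> : ev i - ev j = (i%:R - j%:R) * (- c + (k0 + (i + k0 + j)).+1%:R).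
    by rewrite /ev -!natr1 !natrD; ring.
  rewrite mulf_eq0 subr_eq0 eqr_nat => /orP[/eqP//|].
  by rewrite (negPf (k0P _ _)) // leq_addr.
have [n0 n0P] := dim_le_finite_eigenvalues (act (TW x) f \o act (TW x) e) dW
  ev_inj.
pose n1 := (k0 + n0)%N; exists (mu - n1%:R *: al); split.
  exists (iter n1 (act (TW x) f) v0); split; first exact: weight_iter_f.
  rewrite twist_iter_self => v1; apply: v00.
  by rewrite -[v0](iter_cancel n1 fK) v1 iter_linear0.
move=> n u; rewrite -addrA -opprD -scalerDl -natrD addnS => lu eu0.
pose w := iter (n1 + n).+1 g u.
have mu_w : weight_space (TW x) mu w by apply: inverse_weight.
have uw : u = iter (n1 + n).+1 (act (TW x) f) w.
  by rewrite twist_iter_self; apply/esym/(iter_cancel _ gK).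
rewrite uw; suff -> : w = 0 by rewrite iter_linear0.
apply: (n0P (n0 + n)%N) => //; first exact: leq_addr.
have := sl2_iter cartan_H even_e root_f br_ef al_a (n1 + n) mu_w.
rewrite -uw eu0 iterSr -iter_linearZ -iter_linearD.
have inj n' : injective (iter n' (act (TW x) f)).
  move=> u1 u2; rewrite !twist_iter_self; exact: (can_inj (iter_cancel n' fK)).
rewrite -[X in X = _](iter_linear0 (act (TW x) f) (n1 + n)) => /inj/esym/eqP.
rewrite addr_eq0 => /eqP few.
by rewrite [LHS]few -scaleNr /ev /n1 addnA.
Qed.

(** The weight la does not depend on N. For v of weight la, some f^n v lies in N, and one descends
    from f^(n+1) v to f^n v: e f is injective on that finite dimensional weight space and sends f^n
    v into N. *)
Lemma socle_neq0 x : weight_module H MM -> exists v, socle x v /\ v <> 0.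
Proof.
move=> wM; have [la [[v [la_v v0]] inj_e]] :=
  exists_raising_injective_string x wM.
have inj_f : injective (act (TW x) f).
  move=> u w; rewrite !twist_act_self; exact: can_inj.
exists v; split=> // N sN N0.
have [n] := twist_saturation sN N0 v; rewrite -(twist_iter_self x).
have subN := submodule_subspace sN.
elim: n => // n IHn Nfv; apply: IHn; have := weight_iter_f cartan_H root_f n la_v.
set w := iter n _ _ in Nfv * => lw.
have [d dW] : exists d, dim_le (weight_space (TW x) (la - n%:R *: al)) d.
  by rewrite twist_weight_spaceE.
have lf u : weight_space (TW x) (la - n%:R *: al) u ->
    weight_space (TW x) (la - n.+1%:R *: al) (act (TW x) f u).
  by move=> lu; rewrite -natr1 scalerDl scale1r opprD addrA; apply: weight_act.
apply: (@dim_le_mem_image _ _ (act (TW x) e \o act (TW x) f) _ _ _ _ dW) => //=.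
- exact: weight_subspace.
- move=> u /lf lu; rewrite -[X in weight_space _ X _](subrK al).
  have -> : la - n%:R *: al = la - n.+1%:R *: al + al.
    by rewrite -natr1 scalerDl scale1r opprD addrA subrK.
  by rewrite subrK; apply: weight_act.
- move=> u /lf lu eu; apply: inj_f; rewrite act0r; exact: inj_e lu eu.
- by move=> u Nu; do 2!apply: sN.2.
- by apply: sN.2.
Qed.

(** A nonzero graded submodule of the socle is a nonzero graded submodule of the twisted module, so
    it contains the socle. *)
Lemma socle_simple x : weight_module H MM ->
  simple_module (sub_superModule (socle_submodule x)).
Proof.
move=> wM; split.
  have [v [Sv v0]] := socle_neq0 x wM;
    exists (in_subcarrier (socle_submodule x) Sv).
  by move=> /(congr1 (@subcarrier_val _ _ _ _ _ _ _)) /= /v0.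
move=> P [subP gradP] PT;
  pose N := [set m | exists2 u, P u & subcarrier_val u = m].
have sN : submodule (TW x) N.
  split; first split.
  - split; first by exists 0 => //; apply: subP.1.
    move=> k _ _ [u Pu <-] [w Pw <-]; exists (k *: u + w) => //.
    exact: subP.2.
  - move=> v0 v1 e0 o1 [u Pu uE].
    have [S0 S1] : socle x v0 /\ socle x v1.
      apply: (socle_submodule x).1.2 => //; rewrite -uE; exact: subcarrierP.
    have [|||P0 P1] := gradP (in_subcarrier (socle_submodule x) S0)
      (in_subcarrier (socle_submodule x) S1) => //.
      suff <- : u = in_subcarrier (socle_submodule x) S0 +
        in_subcarrier (socle_submodule x) S1 by [].
      exact: val_inj.
    split; first by exists (in_subcarrier (socle_submodule x) S0).
    by exists (in_subcarrier (socle_submodule x) S1).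
  - move=> y _ [u Pu <-];
      exists (act (sub_superModule (socle_submodule x)) y u) => //.
    exact: PT.
have [P0|/existsNP[u /not_implyP[Pu u0]]] := pselect (forall u, P u -> u = 0).
  by left.
right=> w; have [|w' Pw' /val_inj <- //] := subcarrierP w N sN.
exists (subcarrier_val u); split; first by exists u.
by move=> v0; apply: u0; apply: val_inj.
Qed.

(** The vectors killed by a power of e form a submodule; being nonzero, it contains the socle. *)
Lemma socle_locally_nilpotent x :
  (exists v, v <> 0 /\ act (TW x) e v = 0) ->
  locally_nilpotent (sub_superModule (socle_submodule x)) e.
Proof.
move=> [v0 [v00 ev0]] u.
have := subcarrierP u _ (submodule_saturation nil_e even_e (submodule_zero (TW
  x))).
case=> [|n nu]; first by exists v0; split=> //; exists 1%N.
by exists n; apply: val_inj; rewrite [LHS]val_iter_sub_act.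
Qed.

Lemma socle_iso_twisted x : weight_module H MM ->
  iso_twisted f (sub_superModule (socle_submodule x)) MM (- x).
Proof.
move=> wM; have [v Sv] := socle_neq0 x wM.
have TfK : cancel (act (TW x) f) g by move=> u; rewrite twist_act_self fK.
have TgK : cancel g (act (TW x) f) by move=> u; rewrite twist_act_self gK.
apply: (iso_twisted_localize even_f nil_f TfK TgK).
- move=> m; have [|n Sn] := twist_saturation (socle_submodule x) _ m.
    by exists v.
  by exists n; rewrite twist_iter_self.
- by [].
- by move=> n y m; apply: twist_act_opp.
Qed.

End TwistedWeights.

Lemma exists_twist_parameter (K : numClosedFieldType) (L : lmodType K)
    (LL : lieSuper L) (A : affinization LL) (H : {vspace fin_space A})
    (al : cartan_dual H) (e f : L) (a : cartan H)
    (even_e : lhom LL false e) (even_f : lhom LL false f)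
    (nil_f : forall y, exists n, iter n (br LL f) y = 0)
    (M : lmodType K) (MM : superModule LL M) (g : {linear M -> M})
    (fK : cancel (act MM f) g) (gK : cancel g (act MM f)) :
  fin_cartan H -> root_space al e -> root_space (- al) f ->
  br LL e f = cartan_in a -> al a = 2 -> weight_module H MM ->
  (forall la : cartan_dual H, exists n, dim_le (weight_space MM la) n) ->
  (exists v : M, v <> 0) ->
  exists x v, v <> 0 /\ act (twist even_f nil_f fK gK x) e v = 0.
Proof.
move=> cartan_H root_e root_f br_ef al_a wM fM M0.
have [la [v [la_v v0]]] := exists_weight_vector wM M0; have [d dW] := fM la.
have [||mu [w [la_w w0 efw]]] := @exists_eigenvector _ _
    (act MM e \o act MM f) _ _ _ dW _ _ la_v v0.
- exact: weight_subspace.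
- move=> u lu /=; rewrite -[la](subrK al); apply: weight_act => //.
  exact: weight_act.
(* With e f w = mu w, the twisted e sends f w to (mu - c x - x (x - 1)) w, so x must solve x^2 = mu
   + (1 - c) x. *)
pose c := la a; pose P i : K := if i == 0%N then mu else 1 - c.
have [x xE] := solve_monicpoly P (isT : (0 < 2)%N).
exists x, (act MM f w); split.
  by move=> fw0; apply: w0; rewrite -[w]fK fw0 linear0.
have fe : br LL f e = - cartan_in a by rewrite br_skew_even // br_ef.
have fa : br LL f (cartan_in a) = 2 *: f.
  by rewrite br_skew_even // root_f opp_lfunE al_a scaleNr opprK.
have two : (2 : K) != 0 by rewrite pnatr_eq0.
have ff := br_even_self two even_f.
rewrite /= (@twist_actE _ _ _ _ nil_f _ _ g _ e _ 3); last first.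
  by rewrite /= fe linearN /= fa linearN linearZ /= ff scaler0 oppr0.
rewrite !big_ord_recr big_ord0 /= fe linearN /= fa.
rewrite -!scaleN1r !actZl !fK -[act MM e _]/((act MM e \o act MM f) w) efw.
rewrite la_w !gK !binomial_coefSE binomial_coef0 !scalerA add0r -!scalerDl.
have -> : mu = x ^+ 2 - (1 - c) * x.
  by rewrite xE !big_ord_recr big_ord0 /P /=; ring.
rewrite -[RHS](scale0r w); congr (_ *: _); by rewrite /c; field.
Qed.

(** * Strings in the direction of an arbitrary real root *)

Section RealRoots.
Variables (K : numFieldType) (L : lmodType K) (LL : lieSuper L).
Variables (A : affinization LL) (H : {vspace fin_space A}).
Hypothesis cartan_H : fin_cartan H.
Implicit Types (la be : cartan_dual H).

Lemma root_space_graded be x0 x1 : lhom LL false x0 -> lhom LL true x1 ->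
  root_space be (x0 + x1) -> root_space be x0 /\ root_space be x1.
Proof.
move=> e0 o1 bx; have subL p := lhom_subspace LL p.
suff eq0 b : br LL (cartan_in b) x0 - be b *: x0 = 0.
  split=> b; first by apply/eqP; rewrite -subr_eq0 eq0.
  have /eqP := bx b; rewrite linearD scalerDr /= => /eqP bx1.
  apply: (addrI (br LL (cartan_in b) x0)); rewrite bx1; congr (_ + _).
  by apply/esym/eqP; rewrite -subr_eq0 eq0.
have eb := cartan_in_even cartan_H b; apply: (@lhom_disjoint _ _ LL).
  by apply: subspaceB => //; [exact: lhom_br_even|exact: subspaceZ].
have -> : br LL (cartan_in b) x0 - be b *: x0 =
    - (br LL (cartan_in b) x1 - be b *: x1).
  apply/eqP; rewrite -addr_eq0 addrACA -opprD -scalerDr -linearD /=.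
  by rewrite bx subrr.
apply: subspaceN => //.
by apply: subspaceB => //; [exact: lhom_br_even|exact: subspaceZ].
Qed.

Variables (M : lmodType K) (MM : superModule LL M).

(* When only the odd part of the root space is nonzero, the square of an odd
   root vector makes 2 be an even root, and the be-string splits into two
   (2 be)-strings. *)
Lemma R_ln_string_bounded be :
  (forall la, exists n, dim_le (weight_space MM la) n) -> R_ln MM be ->
  forall la, exists n0, forall n v,
    (n0 <= n)%N -> weight_space MM (la + n%:R *: be) v -> v = 0.
Proof.
move=> fM [[[x [bx x0]] be0] ln_be] la.
have nd : nondegenerate_weight be by apply: real_root_nondegenerate;
  split=> //; exists x.
have [x0' [x1 [e0 o1 xE]]] := lhomP LL x.
have [bx0 bx1] : root_space be x0' /\ root_space be x1.
  by apply: root_space_graded => //; rewrite -xE.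
have [x00|/eqP x00] := eqVneq x0' 0; last first.
  have [f [a [ef bf efa ba]]] := sl2_triple cartan_H nd bx0 e0 x00.
  have ln_e : locally_nilpotent MM x0' by apply: ln_be.
  exact: (string_bounded cartan_H e0 bx0 bf efa ba fM ln_e).
have x10 : x1 <> 0 by move=> x10; apply: x0; rewrite xE x00 x10 addr0.
have [b2 e2 x20] := odd_root_square cartan_H nd bx1 o1 x10.
have [f [a [ef bf efa ba]]] :=
  sl2_triple cartan_H (nondegenerate_weightMn2 nd) b2 e2 x20.
have ln_e : locally_nilpotent MM (br LL x1 x1).
  move=> v; have [n nv] := ln_be _ bx1 x10 v; exists n.
  have sq u : act MM (br LL x1 x1) u = 2%:R *: act MM x1 (act MM x1 u).
    by rewrite (act_br MM _ o1 o1) /= scaleN1r opprK scaler_nat mulr2n.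
  have -> : iter n (act MM (br LL x1 x1)) v = 2%:R ^+ n *: iter n.*2 (act MM
    x1) v.
    elim: (n) => [|k IHk]; first by rewrite scale1r.
    by rewrite iterS IHk linearZ /= sq scalerA exprSr.
  by rewrite (iter_linear_eq0 _ nv) ?scaler0 // -addnn leq_addr.
have bounded := string_bounded cartan_H e2 b2 bf efa ba fM ln_e.
have [n1 n1P] := bounded la; have [n2 n2P] := bounded (la + be).
(* Even multiples of be are reached from la and odd ones from la + be, each by n./2 steps of 2
   be. *)
exists (maxn n1 n2).*2.+1 => n v le_n lv.
have le12 : (maxn n1 n2 <= n./2)%N by lia.
move: le12; rewrite geq_max => /andP[le1 le2].
have nE : n%:R *: be = (odd n)%:R *: be + n./2%:R *: (2%:R *: be).
  by rewrite scalerA -natrM -scalerDl -natrD muln2 odd_double_half.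
move: lv; rewrite nE addrA; case: (odd n) => /=.
  rewrite scale1r; exact: n2P.
by rewrite scale0r addr0; apply: n1P.
Qed.

End RealRoots.

(** * Construction of Omega *)

Theorem proposition4p1 (R : realType) (L : lmodType R[i]) (LL : lieSuper L)
    (A : affinization LL) (H : {vspace fin_space A})
    (affine_A : affine_lieSuper A) (cartan_H : fin_cartan H)
    (odd_neq0 : exists x, lhom LL true x /\ x <> 0)
    (not_A_1_odd : forall (B : affinization LL) (l : nat),
       (1 <= l)%N -> ~ type_A2_odd_odd 1 l B)
    (not_type_I : forall B : affinization LL,
       untwisted B -> ~ type_I (fin_alg B))
    (M : lmodType R[i]) (MM : superModule LL M)
    (simple_M : simple_module MM) (admissible_M : admissible H MM)
    (level0_M : level_zero A MM)
    (al : cartan_dual H) (even_al : parity_root false al)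
    (real_al : real_root al)
    (in_al : R_in MM al) (in_opp_al : R_in MM (- al)) :
  exists (Omega : lmodType R[i]) (OO : superModule LL Omega),
    [/\ simple_module OO, admissible H OO, level_zero A OO
      & [/\ exists x : R[i], twisted_localization_using H MM OO x,
            R_ln OO al
          & forall be : cartan_dual H, real_root be ->
              R_ln MM be -> R_ln OO be]].
Proof.
have [[wM fM] _ _] := admissible_M.
have nd_al := real_root_nondegenerate real_al.
have nd_opp := real_root_nondegenerate in_opp_al.1.
have [e [root_e even_e e0]] := even_al.
have [f [a [even_f root_f br_ef al_a]]] :=
  sl2_triple cartan_H nd_al root_e even_e e0.
have f0 : f <> 0.
  move=> f0; apply: e0; have := root_e a;
    rewrite -br_ef f0 linear0 br0l al_a => /esym/eqP.
  by rewrite scaler_eq0 pnatr_eq0 => /eqP.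
have nil_e := even_root_ad_nilpotent cartan_H nd_al root_e even_e.
have nil_f := even_root_ad_nilpotent cartan_H nd_opp root_f even_f.
have inj_e := in_al.2 e root_e e0; have inj_f := in_opp_al.2 f root_f f0.
have [g [fK gK]] := lowering_inverse cartan_H root_e root_f wM fM inj_e inj_f.
have [x ker_e] := exists_twist_parameter even_e even_f nil_f fK gK cartan_H
  root_e root_f br_ef al_a wM fM simple_M.1.
pose sS := socle_submodule even_f nil_f fK gK x.
pose OO := sub_superModule sS.
have admissible_T := twist_admissible even_f root_f nil_f fK gK x admissible_M.
have admissible_O : admissible H OO by apply: sub_admissible.
have [[wO fO] _ _] := admissible_O.
exists (subcarrier sS), OO; split=> //.
- exact: (socle_simple cartan_H even_e even_f root_e root_f br_ef al_a).
- move=> u; apply: val_inj;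
    exact: (twist_level_zero even_f nil_f fK gK x level0_M).
split.
(* The localization inverts f, a root vector for - al, and twisting by - x undoes the twist by x. *)
- exists (- x), (- al), f; split; [by exists f|exact: in_opp_al.1|by []|].
  exact: (socle_iso_twisted cartan_H even_e even_f root_e root_f br_ef al_a).
- have ln_e : locally_nilpotent OO e := socle_locally_nilpotent even_e nil_e
    ker_e.
  (* Nilpotency is known for e; the bound on al-strings extends it to every root vector of weight
     al. *)
  split=> // y root_y _; apply: (string_locally_nilpotent cartan_H wO root_y).
  exact: (string_bounded cartan_H even_e root_e root_f br_ef al_a fO ln_e).
- move=> be real_be ln_be; split=> // y root_y _.
  apply: (string_locally_nilpotent cartan_H wO root_y) => la.
  (* A vector of weight la in Omega has weight la - x al in M, where be-strings are bounded. *)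
  have [n0 n0P] := R_ln_string_bounded cartan_H fM ln_be (la - x *: al).
  exists n0 => n u le_n /sub_weight_space.
  move=> /(twist_weight_space _ root_f); rewrite addrAC => /(n0P n _ le_n) u0.
  exact: val_inj.
Qed.
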